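(* Let $\widetilde{u}=[(u_\varepsilon)_\varepsilon]\in\mathcal{G}_{aaa}$ and $\widetilde{F}=[(f_\varepsilon)_\varepsilon]\in\mathcal{G}_\tau(\mathbb{C})$. Then $$\widetilde{F}\circ\widetilde{u}:=[(f_\varepsilon\circ u_\varepsilon)_\varepsilon]$$ is a well-defined element of $\mathcal{G}_{aaa}$. Moreover, the principal term and the corrective term of $\widetilde{F}\circ\widetilde{u}$ are respectively $\widetilde{F}(\widetilde{u}_{aa})$ and $\widetilde{F}(\widetilde{u}_{aa}+\widetilde{u}_{cor})-\widetilde{F}(\widetilde{u}_{aa})$, where $\widetilde{u}=\widetilde{u}_{aa}+\widetilde{u}_{cor}$ on $\mathbb{J}$ with $\widetilde{u}_{aa}$ and $\widetilde{u}_{cor}$ the principal and corrective terms of $\widetilde{u}$.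
   Context: Notation: $\mathbb{Z}_+=\{0,1,2,\dots\}$, $I:=\,]0,1]$, $\mathbb{J}:=[0,+\infty[$, $\mathbb{I}$ is $\mathbb{R}$ or $\mathbb{J}$. All functions are complex-valued. $\mathcal{C}_b$ is the space of bounded continuous functions on $\mathbb{R}$. A continuous function $g$ on $\mathbb{R}$ is almost automorphic if every real sequence $(s_m)$ has a subsequence $(s_{m_k})_k$ such that $\tilde g(x):=\lim_{k}g(x+s_{m_k})$ exists for every $x\in\mathbb{R}$ and $\lim_k\tilde g(x-s_{m_k})=g(x)$ for every $x\in\mathbb{R}$; $\mathcal{C}_{aa}$ is the space of such functions. $\mathcal{C}_{+,0}$ is the space of $h\in\mathcal{C}_b$ with $\lim_{x\to+\infty}h(x)=0$. $\mathcal{C}_{aaa}$ is the space of $f\in\mathcal{C}_b$ for which there are $g\in\mathcal{C}_{aa}$, $h\in\mathcal{C}_{+,0}$ with $f=g+h$ on $\mathbb{J}$. $\mathcal{B}(\mathbb{I})$ is the space of smooth functions on $\mathbb{I}$ all of whose derivatives are bounded, with $|\varphi|_{k,\infty,\mathbb{I}}:=\sum_{j\le k}\|\varphi^{(j)}\|_{L^\infty(\mathbb{I})}$. $\mathcal{B}_{aa}$ (resp. $\mathcal{B}_{aaa}$) is the space of smooth functions on $\mathbb{R}$ all of whose derivatives (including order $0$) lie in $\mathcal{C}_{aa}$ (resp. $\mathcal{C}_{aaa}$). $\mathcal{B}_{+,0}$ is the space of $\varphi\in\mathcal{B}(\mathbb{R})$ with $\lim_{x\to+\infty}\varphi^{(j)}(x)=0$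 for all $j\in\mathbb{Z}_+$. For a space $X\subset\mathcal{B}(\mathbb{I})$, let $\mathcal{M}_X$ be the set of nets $(u_\varepsilon)_{\varepsilon\in I}\in X^I$ such that $\forall k\in\mathbb{Z}_+\,\exists m\in\mathbb{Z}_+$: $|u_\varepsilon|_{k,\infty,\mathbb{I}}=O(\varepsilon^{-m})$, $\varepsilon\to0$, and $\mathcal{N}_X$ the set of nets in $X^I$ such that $\forall k,m\in\mathbb{Z}_+$: $|u_\varepsilon|_{k,\infty,\mathbb{I}}=O(\varepsilon^{m})$, $\varepsilon\to0$. Set $\mathcal{G}_X:=\mathcal{M}_X/\mathcal{N}_X$. Then $\mathcal{G}_{aaa}$, $\mathcal{G}_{aa}$, $\mathcal{G}_{+,0}$, $\mathcal{G}_{\mathcal{B}}(\mathbb{I})$ are the quotients for $X=\mathcal{B}_{aaa},\mathcal{B}_{aa},\mathcal{B}_{+,0},\mathcal{B}(\mathbb{I})$; the first three are viewed inside $\mathcal{G}_{\mathcal{B}}(\mathbb{R})$. Equality ''on $\mathbb{J}$'' means equality of restrictions (taken on representatives) in $\mathcal{G}_{\mathcal{B}}(\mathbb{J})$. Every $\widetilde{u}\in\mathcal{G}_{aaa}$ can be written $\widetilde{u}=\widetilde{v}+\widetilde{w}$ on $\mathbb{J}$ with $\widetilde{v}\in\mathcal{G}_{aa}$, $\widetilde{w}\in\mathcal{G}_{+,0}$, uniquely on $\mathbb{J}$; $\widetilde{v}=:\widetilde{u}_{aa}$ is called the principal term and $\widetilde{w}=:\widetilde{u}_{cor}$ the corrective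 term of $\widetilde{u}$. Tempered generalized functions on $\mathbb{C}\cong\mathbb{R}^2$: $\mathcal{G}_\tau(\mathbb{C}):=\mathcal{M}_\tau(\mathbb{C})/\mathcal{N}_\tau(\mathbb{C})$, where $\mathcal{M}_\tau(\mathbb{C})$ is the set of nets $(f_\varepsilon)_{\varepsilon\in I}$ of smooth functions on $\mathbb{R}^2$ such that $\forall j\in\mathbb{Z}_+^2\,\exists m\in\mathbb{Z}_+$: $\sup_{x\in\mathbb{R}^2}(1+|x|)^{-m}|f_\varepsilon^{(j)}(x)|=O(\varepsilon^{-m})$, $\varepsilon\to0$; and $\mathcal{N}_\tau(\mathbb{C})$ is the set of such nets of smooth functions with $\forall j\in\mathbb{Z}_+^2\,\exists n\in\mathbb{Z}_+\,\forall m\in\mathbb{Z}_+$: $\sup_{x\in\mathbb{R}^2}(1+|x|)^{-n}|f_\varepsilon^{(j)}(x)|=O(\varepsilon^{m})$, $\varepsilon\to0$. For $\widetilde v=[(v_\varepsilon)_\varepsilon]\in\mathcal{G}_{\mathcal{B}}(\mathbb{R})$, $\widetilde{F}(\widetilde{v}):=[(f_\varepsilon\circ v_\varepsilon)_\varepsilon]$. ''Well-defined'' means independent of the chosen representatives. *)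

(* Defs.v *)
From Stdlib Require Import Reals.
From Coquelicot Require Import Coquelicot.

Open Scope R_scope.

Definition allR (x : R) : Prop := True.
Definition J (x : R) : Prop := 0 <= x.

(** ** Smooth functions of one real variable

    A complex-valued function on the domain [D] (either [allR] or [J]) is
    represented by a function [R -> C] of which only the values on [D] matter.
    Derivatives are taken within [D], so they are one-sided at the end point
    of [J]. *)

Definition is_derive_in (D : R -> Prop) (f : R -> C) (x : R) (l : C) : Prop :=
  filterdiff (K := R_AbsRing) (U := R_NormedModule) (V := C_R_NormedModule)
    f (within D (locally x)) (fun h : R => scal h l).

Definition ex_derive_in (D : R -> Prop) (f : R -> C) (x : R) : Prop :=
  exists l : C, is_derive_in D f x l.

Definition derive_in (D : R -> Prop) (f : R -> C) (x : R) : C :=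
  iota (T := C_R_CompleteNormedModule) (is_derive_in D f x).

Fixpoint derive_n_in (D : R -> Prop) (n : nat) (f : R -> C) : R -> C :=
  match n with
  | O => f
  | S n' => derive_in D (derive_n_in D n' f)
  end.

Definition smooth_in (D : R -> Prop) (f : R -> C) : Prop :=
  forall n x, D x -> ex_derive_in D (derive_n_in D n f) x.

Definition sup_over {T : Type} (D : T -> Prop) (h : T -> R) : Rbar :=
  Lub_Rbar (fun y => exists x, D x /\ y = h x).

(* For continuous functions the essential supremum is the supremum. *)
Definition sup_norm (D : R -> Prop) (f : R -> C) : Rbar :=
  sup_over D (fun x => Cmod (f x)).

Fixpoint Ck_norm (D : R -> Prop) (k : nat) (f : R -> C) : Rbar :=
  match k with
  | O => sup_norm D f
  | S k' => Rbar_plus (Ck_norm D k' f) (sup_norm D (derive_n_in D k f))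
  end.

Definition bounded_on (D : R -> Prop) (f : R -> C) : Prop :=
  exists M : R, forall x, D x -> Cmod (f x) <= M.

(** ** Function spaces *)

Definition continuous_RC (f : R -> C) : Prop :=
  forall x : R, continuous (T := R_UniformSpace) (U := C_UniformSpace) f x.

Definition C_b (f : R -> C) : Prop := continuous_RC f /\ bounded_on allR f.

Definition seq_lim (u : nat -> C) (l : C) : Prop :=
  filterlim u eventually (locally (T := C_UniformSpace) l).

Definition tends_to_0_at_infty (f : R -> C) : Prop :=
  filterlim f (Rbar_locally p_infty) (locally (T := C_UniformSpace) (RtoC 0)).

Definition C_aa (g : R -> C) : Prop :=
  continuous_RC g /\
  forall s : nat -> R,
    exists phi : nat -> nat, (forall k, (phi k < phi (S k))%nat) /\
    exists gt : R -> C,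
      (forall x, seq_lim (fun k => g (x + s (phi k))) (gt x)) /\
      (forall x, seq_lim (fun k => gt (x - s (phi k))) (g x)).

Definition C_p0 (h : R -> C) : Prop := C_b h /\ tends_to_0_at_infty h.

Definition C_aaa (f : R -> C) : Prop :=
  C_b f /\
  exists g h : R -> C,
    C_aa g /\ C_p0 h /\ forall x, J x -> f x = Cplus (g x) (h x).

Definition B_on (D : R -> Prop) (f : R -> C) : Prop :=
  smooth_in D f /\ forall n, bounded_on D (derive_n_in D n f).

Definition B_aa (f : R -> C) : Prop :=
  smooth_in allR f /\ forall n, C_aa (derive_n_in allR n f).

Definition B_aaa (f : R -> C) : Prop :=
  smooth_in allR f /\ forall n, C_aaa (derive_n_in allR n f).

Definition B_p0 (f : R -> C) : Prop :=
  B_on allR f /\ forall n, tends_to_0_at_infty (derive_n_in allR n f).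

(** ** Nets and asymptotics *)

Definition index : Type := {e : R | 0 < e <= 1}.

Definition net : Type := index -> R -> C.

(* [a] is O(b) as the parameter tends to 0. *)
Definition bigO (a : index -> Rbar) (b : R -> R) : Prop :=
  exists K e0 : R, 0 < e0 /\
    forall e : index, proj1_sig e < e0 ->
      Rbar_le (Rbar_abs (a e)) (K * Rabs (b (proj1_sig e))).

Definition net_plus (u v : net) : net := fun e x => Cplus (u e x) (v e x).
Definition net_minus (u v : net) : net := fun e x => Cminus (u e x) (v e x).

Definition moderate (D : R -> Prop) (X : (R -> C) -> Prop) (u : net) : Prop :=
  (forall e, X (u e)) /\
  forall k : nat, exists m : nat,
    bigO (fun e => Ck_norm D k (u e)) (fun e => / e ^ m).

Definition negligible (D : R -> Prop) (X : (R -> C) -> Prop) (u : net) : Prop :=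
  (forall e, X (u e)) /\
  forall k m : nat, bigO (fun e => Ck_norm D k (u e)) (fun e => e ^ m).

(** ** The quotients

    A generalized function is an equivalence class, that is a set of moderate
    nets.  [class_of D X P] is the union of the classes, modulo negligible nets,
    of the nets in [P]; it is a single class exactly when the nets in [P] are
    moderate and pairwise equivalent and [P] is nonempty.  Operations on classes
    which are given by a formula on representatives are obtained by taking for
    [P] the set of all values of the formula. *)

Definition gfun : Type := net -> Prop.

Definition class_of (D : R -> Prop) (X : (R -> C) -> Prop) (P : net -> Prop)
  : gfun :=
  fun w => moderate D X w /\ exists u, P u /\ negligible D X (net_minus w u).

Definition class (D : R -> Prop) (X : (R -> C) -> Prop) (u : net) : gfun :=
  class_of D X (fun u' => u' = u).

Definition G (D : R -> Prop) (X : (R -> C) -> Prop) (U : gfun) : Prop :=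
  exists u, moderate D X u /\ U = class D X u.

Definition G_aaa : gfun -> Prop := G allR B_aaa.
Definition G_aa : gfun -> Prop := G allR B_aa.
Definition G_p0 : gfun -> Prop := G allR B_p0.

(* The canonical map from the quotient of a subspace of B(R) into G_B(R). *)
Definition embed (U : gfun) : gfun := class_of allR (B_on allR) U.

(* Membership in a quotient [GX] viewed inside G_B(R). *)
Definition embedded (GX : gfun -> Prop) (V : gfun) : Prop :=
  exists V0, GX V0 /\ V = embed V0.

(* The restriction map from G_B(R) to G_B(J). *)
Definition restrict_J (U : gfun) : gfun := class_of J (B_on J) U.

Definition eq_on_J (U V : gfun) : Prop := restrict_J U = restrict_J V.

(* Sum and difference in G_B(R). *)
Definition gplus (U V : gfun) : gfun :=
  class_of allR (B_on allR)
    (fun w => exists u v, U u /\ V v /\ w = net_plus u v).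

Definition gminus (U V : gfun) : gfun :=
  class_of allR (B_on allR)
    (fun w => exists u v, U u /\ V v /\ w = net_minus u v).

(* [U], [V], [W] are elements of G_B(R); [V] and [W] are determined on J
   by [U]. *)
Definition principal_corrective (U V W : gfun) : Prop :=
  embedded G_aa V /\ embedded G_p0 W /\ eq_on_J U (gplus V W).

(** ** Tempered generalized functions on C, identified with R^2 *)

Definition ex_partial1 (f : C -> C) (z : C) : Prop :=
  ex_derive_in allR (fun t => f (t, Im z)) (Re z).
Definition ex_partial2 (f : C -> C) (z : C) : Prop :=
  ex_derive_in allR (fun t => f (Re z, t)) (Im z).

Definition partial1 (f : C -> C) (z : C) : C :=
  derive_in allR (fun t => f (t, Im z)) (Re z).
Definition partial2 (f : C -> C) (z : C) : C :=
  derive_in allR (fun t => f (Re z, t)) (Im z).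

Fixpoint class_Cn (n : nat) (f : C -> C) : Prop :=
  (forall z : C, continuous (T := C_UniformSpace) (U := C_UniformSpace) f z) /\
  match n with
  | O => True
  | S n' =>
      (forall z, ex_partial1 f z /\ ex_partial2 f z) /\
      class_Cn n' (partial1 f) /\ class_Cn n' (partial2 f)
  end.

Definition smooth2 (f : C -> C) : Prop := forall n, class_Cn n f.

Fixpoint iter_op (n : nat) (op : (C -> C) -> C -> C) (f : C -> C) : C -> C :=
  match n with
  | O => f
  | S n' => op (iter_op n' op f)
  end.

Definition partial_n (j1 j2 : nat) (f : C -> C) : C -> C :=
  iter_op j1 partial1 (iter_op j2 partial2 f).

Definition weighted_sup (m : nat) (f : C -> C) : Rbar :=
  sup_over (fun _ : C => True) (fun z => / (1 + Cmod z) ^ m * Cmod (f z)).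

Definition net2 : Type := index -> C -> C.

Definition net2_minus (f g : net2) : net2 := fun e z => Cminus (f e z) (g e z).

Definition moderate_tau (f : net2) : Prop :=
  (forall e, smooth2 (f e)) /\
  forall j1 j2 : nat, exists m : nat,
    bigO (fun e => weighted_sup m (partial_n j1 j2 (f e))) (fun e => / e ^ m).

Definition negligible_tau (f : net2) : Prop :=
  (forall e, smooth2 (f e)) /\
  forall j1 j2 : nat, exists n : nat, forall m : nat,
    bigO (fun e => weighted_sup n (partial_n j1 j2 (f e))) (fun e => e ^ m).

Definition class_tau (f : net2) : net2 -> Prop :=
  fun g => moderate_tau g /\ negligible_tau (net2_minus g f).

Definition G_tau (F : net2 -> Prop) : Prop :=
  exists f, moderate_tau f /\ F = class_tau f.

Definition net_comp (f : net2) (u : net) : net := fun e x => f e (u e x).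

(* Composition of [F] with [U], as a class in the quotient built on [X]. *)
Definition gcomp (X : (R -> C) -> Prop) (F : net2 -> Prop) (U : gfun) : gfun :=
  class_of allR X (fun w => exists f u, F f /\ U u /\ w = net_comp f u).

(* Main.v *)
Require Import Defs.
From Stdlib Require Import Reals Lra Lia ClassicalEpsilon FunctionalExtensionality PropExtensionality.
From Coquelicot Require Import Coquelicot.

(** By the chain rule [(f o u)' = (d1 f o u) Re u' + (d2 f o u) Im u'], so an
    induction on the order shows: if a class [A] of nets is an algebra stable
    under composition with tempered nets, then so is the class of the nets all
    of whose derivatives are in [A].  If moreover [N] is an [A]-module such that
    [u - v] in [N] implies [f o u - f o v] in [N], then the same holds for the
    derivatives of all orders, because [(f o u)' - (f o v)'] is the sum over
    [i = 1, 2] of [(di f o u - di f o v) u_i' + (di f o v) (u_i - v_i)'].  Taking for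
    [A] the almost automorphic, asymptotically almost automorphic, bounded or
    moderate nets, and for [N] the negligible nets (on the line or on the
    half-line) or the nets vanishing at infinity, gives all the assertions.
    Stability of the order-zero classes comes from the local Lipschitz
    continuity of smooth functions on the plane. *)

(** * Derivatives of complex-valued functions *)

(** Membership in [B_aa] or [B_aaa] constrains each derivative separately; this is why one induction
    on the order serves every class, given a stability fact at order zero.

    The delicate fact is quantitative. A moderate net takes values in balls whose radius may grow
    like a power of [1 / e], so a Lipschitz constant for each single [f e] says nothing about
    negligibility. Temperedness keeps the partial derivatives below another power of [1 / e] on
    these balls, and a negligible difference absorbs that power. In the function spaces [e] is fixed
    and any Lipschitz constant on a ball is enough.

    The half-line is the second obstacle: equality on [J] is measured with derivatives within [J],
    while the chain rule is established on the whole line. Representatives are smooth on the line,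
    so both kinds of derivative agree on [J]; the induction keeps whole-line derivatives and
    restricts only the estimates.

    A generalized function is a set of nets and an operation collects its values on all
    representatives, so each identity between classes becomes the negligibility of a difference of
    explicit nets. *)

Definition upward (D : R -> Prop) : Prop := forall x y, D x -> x <= y -> D y.

Lemma upward_allR : upward allR.
Proof. intros x y _ _; exact I. Qed.

Lemma upward_J : upward J.
Proof. unfold upward, J; intros; lra. Qed.

Lemma Cmod_le_Re_Im (z : C) : Cmod z <= Rabs (Re z) + Rabs (Im z).
Proof.
  replace (Cmod z) with (Cmod (Cplus (RtoC (Re z)) (Cmult Ci (RtoC (Im z))))).
  - eapply Rle_trans; [apply Cmod_triangle|].
    rewrite Cmod_mult, Cmod_Ci, !Cmod_R; lra.
  - f_equal; apply injective_projections; unfold Re, Im; simpl; ring.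
Qed.

Lemma im_le_Cmod (z : C) : Rabs (Im z) <= Cmod z.
Proof. eapply Rle_trans; [apply Rmax_r | apply Rmax_Cmod]. Qed.

Lemma within_allR (x : R) : within allR (locally x) = locally x.
Proof.
  apply functional_extensionality; intros P; apply propositional_extensionality.
  split; intros [d Hd]; exists d; intros y Hy; [apply (Hd y Hy I) | intros _; apply (Hd y Hy)].
Qed.

Lemma filter_within_locally (D : R -> Prop) (x : R) : Filter (within D (locally x)).
Proof. apply within_filter, locally_filter. Qed.

Lemma is_derive_in_components (D : R -> Prop) (f : R -> C) (x : R) (l : C) :
  is_derive_in D f x l <->
  filterdiff (K := R_AbsRing) (V := R_NormedModule) (fun t => Re (f t))
    (within D (locally x)) (fun h => scal h (Re l)) /\
  filterdiff (K := R_AbsRing) (V := R_NormedModule) (fun t => Im (f t))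
    (within D (locally x)) (fun h => scal h (Im l)).
Proof.
  assert (FF := filter_within_locally D x).
  unfold is_derive_in; split.
  - intros H; split.
    + apply (filterdiff_comp (V := C_R_NormedModule) f Re (fun h => scal h l) Re H).
      apply (filterdiff_linear (U := C_R_NormedModule) (V := R_NormedModule) Re), is_linear_fst.
    + apply (filterdiff_comp (V := C_R_NormedModule) f Im (fun h => scal h l) Im H).
      apply (filterdiff_linear (U := C_R_NormedModule) (V := R_NormedModule) Im), is_linear_snd.
  - intros [H1 H2].
    (* Over the reals, [f] is [Re f] times the vector [1] plus [Im f] times the vector [Ci]. *)
    assert (H3 := filterdiff_plus_fct (V := C_R_NormedModule) _ _ _ _
       (filterdiff_scal_l_fct (V := C_R_NormedModule) (RtoC 1) _ _ H1)
       (filterdiff_scal_l_fct (V := C_R_NormedModule) Ci _ _ H2)).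
    eapply filterdiff_ext_lin; [eapply filterdiff_ext; [|exact H3]|].
    + intros y. cbn. unfold prod_plus, prod_scal, scal, plus, mult; simpl.
      apply injective_projections; simpl; unfold mult; simpl; unfold Re, Im; ring.
    + intros y. cbn. unfold prod_plus, prod_scal, scal, plus, mult; simpl.
      apply injective_projections; simpl; unfold mult; simpl; unfold Re, Im; ring.
Qed.

Lemma is_derive_in_allR (f : R -> C) (x : R) (l : C) :
  is_derive_in allR f x l <->
  is_derive (fun t => Re (f t)) x (Re l) /\ is_derive (fun t => Im (f t)) x (Im l).
Proof. rewrite is_derive_in_components, within_allR; reflexivity. Qed.

Lemma is_derive_in_eps (D : R -> Prop) (f : R -> C) (x : R) (l : C) (eps : posreal) :
  D x -> is_derive_in D f x l ->
  within D (locally x) (fun y => Cmod (Cminus (Cminus (f y) (f x)) (Cmult (RtoC (y - x)) l))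
                                 <= eps * Rabs (y - x)).
Proof.
  intros Dx [_ H].
  assert (Hx : is_filter_lim (within D (locally x)) x).
  { intros P [d Hd]; exists d; intros y Hy _; apply Hd, Hy. }
  specialize (H x Hx eps).
  revert H; apply filter_imp; intros y Hy.
  rewrite <- Cmod_norm in Hy. 
  replace (Cminus (Cminus (f y) (f x)) (Cmult (RtoC (y - x)) l)) with
  (minus (minus (f y) (f x)) (scal (minus y x) l : C_R_NormedModule)); [exact Hy|].
  unfold minus, plus, opp, scal; simpl; unfold prod_plus, prod_opp, prod_scal; simpl.
  apply injective_projections; simpl; unfold plus, opp, scal, mult; simpl; unfold mult; simpl; ring.
Qed.

Lemma is_derive_in_unique (D : R -> Prop) (f : R -> C) (x : R) (l1 l2 : C) :
  upward D -> D x -> is_derive_in D f x l1 -> is_derive_in D f x l2 -> l1 = l2.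
Proof.
  intros HD Dx H1 H2.
  destruct (Req_dec (Cmod (Cminus l1 l2)) 0) as [E|E].
  - apply Cmod_eq_0 in E. rewrite <- (Cplus_0_r l2), <- E. ring.
  - exfalso. set (m := Cmod (Cminus l1 l2)) in *.
    assert (Hm : 0 < m) by (assert (0 <= m) by apply Cmod_ge_0; lra).
    (* With error [m / 4] in each expansion, a common increment [h] gives [h * m <= h * m / 2],
       absurd for positive [h] and [m]. *)
    assert (Hm4 : 0 < m / 4) by lra.
    assert (K1 := is_derive_in_eps D f x l1 (mkposreal _ Hm4) Dx H1).
    assert (K2 := is_derive_in_eps D f x l2 (mkposreal _ Hm4) Dx H2).
    destruct K1 as [d1 K1], K2 as [d2 K2].
    (* A positive increment stays in [D] by upward closure, also at the end point of [J]. *)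
    set (h := Rmin d1 d2 / 2).
    assert (Hh : 0 < h /\ h < d1 /\ h < d2).
    { assert (0 < Rmin d1 d2) by (apply Rmin_pos; apply cond_pos).
      assert (Rmin d1 d2 <= d1) by apply Rmin_l.
      assert (Rmin d1 d2 <= d2) by apply Rmin_r. unfold h; lra. }
    assert (B : forall d : posreal, h < d -> ball x d (x + h)).
    { intros d Hd. unfold ball; simpl; unfold AbsRing_ball, abs, minus, plus, opp; simpl.
      replace (x + h + - x) with h by ring. rewrite Rabs_pos_eq; lra. }
    assert (Dh : D (x + h)) by (apply (HD x); [exact Dx | lra]).
    specialize (K1 (x + h) (B d1 (proj1 (proj2 Hh))) Dh).
    specialize (K2 (x + h) (B d2 (proj2 (proj2 Hh))) Dh).
    replace (x + h - x) with h in * by ring. simpl pos in *.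
    rewrite (Rabs_pos_eq h) in * by lra.
    assert (E2 : Cmod (Cmult (RtoC h) (Cminus l1 l2)) = h * m).
    { rewrite Cmod_mult, Cmod_R, Rabs_pos_eq; [reflexivity | lra]. }
    assert (T := Cmod_triangle (Cminus (Cminus (f (x + h)) (f x)) (Cmult (RtoC h) l2))
       (Copp (Cminus (Cminus (f (x + h)) (f x)) (Cmult (RtoC h) l1)))).
    rewrite Cmod_opp in T.
    replace (Cplus _ _) with (Cmult (RtoC h) (Cminus l1 l2)) in T by ring.
    rewrite E2 in T. nra.
Qed.

Lemma derive_in_unique (D : R -> Prop) (f : R -> C) (x : R) (l : C) :
  upward D -> D x -> is_derive_in D f x l -> derive_in D f x = l.
Proof.
  intros HD Dx H. apply (iota_unique (V := C_R_CompleteNormedModule)); [|exact H].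
  intros y Hy. exact (is_derive_in_unique D f x y l HD Dx Hy H).
Qed.

Lemma derive_in_correct (D : R -> Prop) (f : R -> C) (x : R) :
  upward D -> D x -> ex_derive_in D f x -> is_derive_in D f x (derive_in D f x).
Proof. intros HD Dx [l H]. rewrite (derive_in_unique D f x l); assumption. Qed.

Lemma is_derive_in_ext (D : R -> Prop) (f g : R -> C) (x : R) (l : C) :
  (forall y, D y -> f y = g y) -> D x -> is_derive_in D f x l -> is_derive_in D g x l.
Proof.
  intros E Dx. apply filterdiff_ext_loc.
  - exists (mkposreal 1 Rlt_0_1); intros y _ Dy; exact (E y Dy).
  (* Agreement is also required at every limit of the filter. Since [x] itself lies in [D], the only
     such limit is [x]. *)
  - intros y Hy. replace y with x; [exact (E x Dx)|].
    apply eq_close; intros eps. apply ball_sym.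
    destruct (Hy (ball y eps) (locally_ball y eps)) as [d Hd].
    exact (Hd x (ball_center x d) Dx).
Qed.

Lemma is_derive_in_allR_restrict (D : R -> Prop) (f : R -> C) (x : R) (l : C) :
  D x -> is_derive_in allR f x l -> is_derive_in D f x l.
Proof.
  unfold is_derive_in; rewrite within_allR; intros Dx [L H]; split; [exact L|].
  intros y Hy eps.
  assert (E : x = y).
  { apply eq_close; intros e. apply ball_sym.
    destruct (Hy (ball y e) (locally_ball y e)) as [d Hd].
    exact (Hd x (ball_center x d) Dx). }
  subst y. apply filter_le_within, H. intros P HP; exact HP.
Qed.

Lemma is_derive_in_plus (D : R -> Prop) (f g : R -> C) (x : R) (l m : C) :
  is_derive_in D f x l -> is_derive_in D g x m ->
  is_derive_in D (fun t => Cplus (f t) (g t)) x (Cplus l m).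
Proof.
  assert (FF := filter_within_locally D x). intros H1 H2.
  eapply filterdiff_ext_lin; [exact (filterdiff_plus_fct (V := C_R_NormedModule) _ _ _ _ H1 H2)|].
  intros y; symmetry; apply (scal_distr_l (V := C_R_NormedModule)).
Qed.

Lemma is_derive_in_minus (D : R -> Prop) (f g : R -> C) (x : R) (l m : C) :
  is_derive_in D f x l -> is_derive_in D g x m ->
  is_derive_in D (fun t => Cminus (f t) (g t)) x (Cminus l m).
Proof.
  assert (FF := filter_within_locally D x). intros H1 H2.
  eapply filterdiff_ext_lin; [exact (filterdiff_minus_fct (V := C_R_NormedModule) _ _ _ _ H1 H2)|].
  intros y; symmetry; apply (scal_minus_distr_l (V := C_R_NormedModule)).
Qed.

Lemma is_derive_in_mult (f g : R -> C) (x : R) (l m : C) :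
  is_derive_in allR f x l -> is_derive_in allR g x m ->
  is_derive_in allR (fun t => Cmult (f t) (g t)) x (Cplus (Cmult l (g x)) (Cmult (f x) m)).
Proof.
  rewrite !is_derive_in_allR. intros [H1 H2] [H3 H4]. split.
  - eapply is_derive_ext; [intros t; symmetry; apply re_mult|].
    evar_last; [apply (is_derive_minus (V := R_NormedModule));
     apply (is_derive_mult (K := R_AbsRing)); eauto; intros; apply Rmult_comm|].
    rewrite ?re_plus, ?im_plus, ?re_mult, ?im_mult; unfold minus, plus, opp, mult; simpl; unfold mult; simpl. ring.
  - eapply is_derive_ext; [intros t; symmetry; apply im_mult|].
    evar_last; [apply (is_derive_plus (V := R_NormedModule));
     apply (is_derive_mult (K := R_AbsRing)); eauto; intros; apply Rmult_comm|].
    rewrite ?re_plus, ?im_plus, ?re_mult, ?im_mult; unfold minus, plus, opp, mult; simpl; unfold mult; simpl. ring.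
Qed.

Lemma is_derive_in_Re (f : R -> C) (x : R) (l : C) :
  is_derive_in allR f x l -> is_derive_in allR (fun t => RtoC (Re (f t))) x (RtoC (Re l)).
Proof.
  rewrite !is_derive_in_allR; simpl; intros [H _]; split; [exact H | apply (is_derive_const 0)].
Qed.

Lemma is_derive_in_Im (f : R -> C) (x : R) (l : C) :
  is_derive_in allR f x l -> is_derive_in allR (fun t => RtoC (Im (f t))) x (RtoC (Im l)).
Proof.
  rewrite !is_derive_in_allR; simpl; intros [_ H]; split; [exact H | apply (is_derive_const 0)].
Qed.

(** * Smooth functions on the plane *)

Lemma smooth2_continuous (f : C -> C) (z : C) :
  smooth2 f -> continuous (T := C_UniformSpace) (U := C_UniformSpace) f z.
Proof. intros H; exact (proj1 (H 0%nat) z). Qed.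

Lemma smooth2_partial1 (f : C -> C) : smooth2 f -> smooth2 (partial1 f).
Proof. intros H n; exact (proj1 (proj2 (proj2 (H (S n))))). Qed.

Lemma smooth2_partial2 (f : C -> C) : smooth2 f -> smooth2 (partial2 f).
Proof. intros H n; exact (proj2 (proj2 (proj2 (H (S n))))). Qed.

Lemma is_derive_partial1 (f : C -> C) (x y : R) :
  smooth2 f -> is_derive_in allR (fun t => f (t, y)) x (partial1 f (x, y)).
Proof.
  intros H. apply (derive_in_correct allR (fun t => f (t, y)) x upward_allR I).
  exact (proj1 (proj1 (proj2 (H 1%nat)) (x, y))).
Qed.

Lemma is_derive_partial2 (f : C -> C) (x y : R) :
  smooth2 f -> is_derive_in allR (fun t => f (x, t)) y (partial2 f (x, y)).
Proof.
  intros H. apply (derive_in_correct allR (fun t => f (x, t)) y upward_allR I).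
  exact (proj2 (proj1 (proj2 (H 1%nat)) (x, y))).
Qed.

(** The criteria for differentiability in two variables and for mixed partials are applied to
    real-valued functions; quantifying over [c] treats real and imaginary parts in one proof. *)
Definition component (c : C -> R) : Prop := c = Re \/ c = Im.

Lemma component_derive (c : C -> R) (f : R -> C) (x : R) (l : C) :
  component c -> is_derive_in allR f x l -> is_derive (fun t => c (f t)) x (c l).
Proof. rewrite is_derive_in_allR; intros [-> | ->] [H1 H2]; assumption. Qed.

Lemma component_continuous (c : C -> R) (f : C -> C) (z : C) :
  component c -> smooth2 f ->
  continuous (T := C_UniformSpace) (U := R_UniformSpace) (fun w => c (f w)) z.
Proof.
  intros Hc Hf. apply (continuous_comp (U := C_UniformSpace) (V := C_UniformSpace) f c).
  - apply smooth2_continuous, Hf.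
  - destruct (f z) as [a b], Hc as [-> | ->]; [apply continuous_fst | apply continuous_snd].
Qed.

(** [smooth2] speaks of partial derivatives only. Total differentiability follows because the first
    partial exists nearby and is continuous at the point, while the second exists at the point;
    composition with [Re u] and [Im u] then gives the chain rule. *)
Lemma is_derive_component_comp (c : C -> R) (f : C -> C) (u : R -> C) (t : R) (l : C) :
  component c -> smooth2 f -> is_derive_in allR u t l ->
  is_derive (fun s => c (f (u s))) t
    (c (partial1 f (u t)) * Re l + c (partial2 f (u t)) * Im l).
Proof.
  intros Hc Hf Hu. apply is_derive_in_allR in Hu. destruct Hu as [H1 H2].
  assert (K := is_derive_filterdiff (fun x y => c (f (x, y))) (Re (u t)) (Im (u t))
    (fun x y => c (partial1 f (x, y))) (c (partial2 f (Re (u t), Im (u t))))).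
  assert (E : forall z : C, (Re z, Im z) = z) by (intros [a b]; reflexivity).
  eapply filterdiff_ext_lin.
  - eapply filterdiff_ext; 
     [|apply (filterdiff_comp'_2 (T := R_NormedModule) (U := R_NormedModule) (V := R_NormedModule)
       (W := R_NormedModule) (fun s => Re (u s)) (fun s => Im (u s)) (fun x y => c (f (x, y))) t _ _
       (fun a b => plus (scal a (c (partial1 f (Re (u t), Im (u t)))))
          (scal b (c (partial2 f (Re (u t), Im (u t))))))
       H1 H2); apply K].
    + intros s; simpl; rewrite E; reflexivity.
    + exists (mkposreal 1 Rlt_0_1); intros [a b] _; simpl.
      apply (component_derive c (fun z => f (z, b))), is_derive_partial1; assumption.
    + apply (component_derive c (fun z => f (Re (u t), z))), is_derive_partial2; assumption.
    + apply (continuous_ext (fun w : C => c (partial1 f w))); [intros [a b]; reflexivity|].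
      apply component_continuous; [exact Hc | apply smooth2_partial1, Hf].
  - intros y. rewrite E. unfold plus, scal; simpl; unfold mult; simpl. ring.
Qed.

Lemma is_derive_in_comp (f : C -> C) (u : R -> C) (t : R) (l : C) :
  smooth2 f -> is_derive_in allR u t l ->
  is_derive_in allR (fun s => f (u s)) t
    (Cplus (Cmult (partial1 f (u t)) (RtoC (Re l))) (Cmult (partial2 f (u t)) (RtoC (Im l)))).
Proof.
  intros Hf Hu. apply is_derive_in_allR.
  rewrite re_plus, im_plus, !re_scal_r, !im_scal_r.
  split; apply is_derive_component_comp; try assumption; [left | right]; reflexivity.
Qed.

Lemma component_Schwarz (c : C -> R) (f : C -> C) (x y : R) :
  component c -> smooth2 f ->
  c (partial1 (partial2 f) (x, y)) = c (partial2 (partial1 f) (x, y)).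
Proof.
  intros Hc Hf.
  assert (D1 : forall a b, is_derive (fun z => c (f (z, b))) a (c (partial1 f (a, b)))).
  { intros; apply (component_derive c (fun z => f (z, b))), is_derive_partial1; assumption. }
  assert (D2 : forall a b, is_derive (fun z => c (f (a, z))) b (c (partial2 f (a, b)))).
  { intros; apply (component_derive c (fun z => f (a, z))), is_derive_partial2; assumption. }
  assert (D12 : forall a b, is_derive (fun z => Derive (fun t => c (f (z, t))) b) a
     (c (partial1 (partial2 f) (a, b)))).
  { intros. apply (is_derive_ext (fun z => c (partial2 f (z, b)))).
    - intros t; symmetry; apply is_derive_unique, D2.
    - apply (component_derive c (fun z => partial2 f (z, b))); [exact Hc|].
      apply is_derive_partial1, smooth2_partial2, Hf. }
  assert (D21 : forall a b, is_derive (fun z => Derive (fun t => c (f (t, z))) a) b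
     (c (partial2 (partial1 f) (a, b)))).
  { intros. apply (is_derive_ext (fun z => c (partial1 f (a, z)))).
    - intros t; symmetry; apply is_derive_unique, D1.
    - apply (component_derive c (fun z => partial1 f (a, z))); [exact Hc|].
      apply is_derive_partial2, smooth2_partial1, Hf. }
  assert (CT : forall (g : R -> R -> R) (h : C -> C), smooth2 h -> (forall a b, g a b = c (h (a, b))) ->
     continuity_2d_pt g x y).
  { intros g h Hh E. apply continuity_2d_pt_filterlim. rewrite E.
    apply (filterlim_ext (fun w : C => c (h w))); [intros [a b]; symmetry; apply E|].
    apply (component_continuous c h (x, y) Hc Hh). }
  assert (S := Schwarz (fun a b => c (f (a, b))) x y).
  etransitivity; [symmetry; apply is_derive_unique, D12|].
  etransitivity; [|apply is_derive_unique, D21].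
  apply S.
  - exists (mkposreal 1 Rlt_0_1); intros a b _ _.
    repeat split; eexists; [apply D1 | apply D2 | apply D12 | apply D21].
  - apply (CT _ (partial1 (partial2 f))); [apply smooth2_partial1, smooth2_partial2, Hf|].
    intros a b; apply is_derive_unique, D12.
  - apply (CT _ (partial2 (partial1 f))); [apply smooth2_partial2, smooth2_partial1, Hf|].
    intros a b; apply is_derive_unique, D21.
Qed.

(** [partial_n] applies the derivatives in the second variable innermost, so the derivatives of
    [partial1 f] are recognized as derivatives of [f] only after this exchange. *)
Lemma partial_comm (f : C -> C) :
  smooth2 f -> partial1 (partial2 f) = partial2 (partial1 f).
Proof.
  intros Hf; apply functional_extensionality; intros [x y].
  apply injective_projections.
  - apply (component_Schwarz Re f x y); [left; reflexivity | exact Hf].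
  - apply (component_Schwarz Im f x y); [right; reflexivity | exact Hf].
Qed.

Lemma smooth2_iter_partial2 (n : nat) (f : C -> C) :
  smooth2 f -> smooth2 (iter_op n partial2 f).
Proof. intros H; induction n; simpl; [exact H | apply smooth2_partial2, IHn]. Qed.

Lemma iter_op_succ (n : nat) (op : (C -> C) -> C -> C) (f : C -> C) :
  iter_op n op (op f) = iter_op (S n) op f.
Proof. induction n; simpl in *; [reflexivity | rewrite IHn; reflexivity]. Qed.

Lemma partial_n_partial2 (j1 j2 : nat) (f : C -> C) :
  partial_n j1 j2 (partial2 f) = partial_n j1 (S j2) f.
Proof. unfold partial_n; rewrite iter_op_succ; reflexivity. Qed.

Lemma partial_n_partial1 (j1 j2 : nat) (f : C -> C) :
  smooth2 f -> partial_n j1 j2 (partial1 f) = partial_n (S j1) j2 f.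
Proof.
  intros Hf; unfold partial_n. rewrite <- iter_op_succ; f_equal.
  induction j2 as [|n IH]; simpl; [reflexivity|].
  rewrite IH; symmetry; apply partial_comm, smooth2_iter_partial2, Hf.
Qed.

(* Choosing [delta] below both a modulus of local boundedness and the inverse
   of the local bound makes [/ delta] a local bound, so that the uniform lower
   bound on [delta] given by compactness bounds [f]. *)
Lemma smooth2_bounded_ball (f : C -> C) (r : R) :
  smooth2 f -> exists M, forall z, Cmod z <= r -> Cmod (f z) <= M.
Proof.
  intros Hf.
  assert (L : forall i j : R, exists d : posreal, forall u v : R,
     Rabs (u - i) < d -> Rabs (v - j) < d -> Cmod (f (u, v)) <= / d).
  { intros i j.
    destruct (proj1 (filterlim_locally f (f (i, j))) (smooth2_continuous f (i, j) Hf)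
      (mkposreal 1 Rlt_0_1)) as [d Hd].
    (* Closeness in [C] is measured by components: each one moves by less than 1, hence the modulus
       by less than 2. *)
    set (B := Cmod (f (i, j)) + 2).
    assert (HB : 0 < B) by (unfold B; assert (T := Cmod_ge_0 (f (i, j))); lra).
    assert (Hm : 0 < Rmin d (/ B)) by (apply Rmin_pos; [apply cond_pos | apply Rinv_0_lt_compat, HB]).
    exists (mkposreal _ Hm); simpl; intros u v Hu Hv.
    apply Rle_trans with B.
    - assert (Hb : ball (i, j) d (u, v)).
      { split; eapply Rlt_le_trans; [exact Hu | apply Rmin_l | exact Hv | apply Rmin_l]. }
      destruct (Hd (u, v) Hb) as [B1 B2]. simpl in B1, B2.
      unfold ball in B1, B2; simpl in B1, B2; unfold AbsRing_ball, abs, minus, plus, opp in B1, B2; simpl in B1, B2.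
      assert (T := Cmod_triangle (f (i, j)) (Cminus (f (u, v)) (f (i, j)))).
      replace (Cplus _ _) with (f (u, v)) in T by ring.
      assert (T2 := Cmod_le_Re_Im (Cminus (f (u, v)) (f (i, j)))).
      simpl in T2. unfold B. lra.
    - rewrite <- (Rinv_inv B) at 1. apply Rinv_le_contravar; [exact Hm | apply Rmin_r]. }
  set (delta := fun i j => proj1_sig (constructive_indefinite_description _ (L i j))).
  assert (Hdelta : forall i j u v : R,
     Rabs (u - i) < delta i j -> Rabs (v - j) < delta i j -> Cmod (f (u, v)) <= / delta i j).
  { intros i j; exact (proj2_sig (constructive_indefinite_description _ (L i j))). }
  destruct (compactness_value_2d (- r) r (- r) r delta) as [d Hd].
  exists (/ d). intros [x y] Hz.
  assert (Hx := re_le_Cmod (x, y)); assert (Hy := im_le_Cmod (x, y)); simpl in Hx, Hy.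
  (* Compactness yields the covering point only up to double negation, hence the argument by
     contradiction. *)
  apply Rnot_lt_le; intros Hlt.
  apply (Hd x y); try (apply Rabs_le_between; lra).
  intros [u [v [_ [_ [H1 [H2 H3]]]]]].
  apply (Rlt_not_le _ _ Hlt). eapply Rle_trans; [apply (Hdelta u v); assumption|].
  apply Rinv_le_contravar; [apply cond_pos | exact H3].
Qed.

(** The mean value inequality is applied to the real and imaginary parts separately, which costs the
    factor 2. It asks for the bound on the whole interval centred at [x], not just between [x] and
    [y]. *)
Lemma Cmod_variation (h h' : R -> C) (L x y : R) :
  (forall t, is_derive_in allR h t (h' t)) ->
  (forall t, Rabs (t - x) <= Rabs (y - x) -> Cmod (h' t) <= L) ->
  Cmod (Cminus (h y) (h x)) <= 2 * L * Rabs (y - x).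
Proof.
  intros Hd HL.
  assert (K1 := bounded_variation (fun t => Re (h t)) (fun t => Re (h' t)) L x y).
  assert (K2 := bounded_variation (fun t => Im (h t)) (fun t => Im (h' t)) L x y).
  assert (T := Cmod_le_Re_Im (Cminus (h y) (h x))). simpl in T.
  unfold Re, Im in *.
  assert (Rabs (fst (h y) - fst (h x)) <= L * Rabs (y - x)).
  { apply K1; intros t Ht; split; [apply (proj1 (is_derive_in_allR h t (h' t))), Hd|].
    eapply Rle_trans; [apply re_le_Cmod | apply HL, Ht]. }
  assert (Rabs (snd (h y) - snd (h x)) <= L * Rabs (y - x)).
  { apply K2; intros t Ht; split; [apply (proj1 (is_derive_in_allR h t (h' t))), Hd|].
    eapply Rle_trans; [apply im_le_Cmod | apply HL, Ht]. }
  unfold Rminus in *. lra.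
Qed.

(** The path from [w] to [z] follows the two axes through [(c, b)], each leg costing [2 * L]. On a
    leg the moving coordinate is only known to be within [2 * r] of its start, hence at most [3 * r]
    in absolute value; the other coordinate adds [r], which explains the radius [4 * r]. *)
Lemma smooth2_lipschitz (f : C -> C) (r L : R) :
  smooth2 f ->
  (forall z, Cmod z <= 4 * r -> Cmod (partial1 f z) <= L /\ Cmod (partial2 f z) <= L) ->
  forall z w, Cmod z <= r -> Cmod w <= r ->
  Cmod (Cminus (f z) (f w)) <= 4 * L * Cmod (Cminus z w).
Proof.
  intros Hf HL [a b] [c d] Hz Hw.
  assert (Za := re_le_Cmod (a, b)); assert (Zb := im_le_Cmod (a, b)); simpl in Za, Zb.
  assert (Wa := re_le_Cmod (c, d)); assert (Wb := im_le_Cmod (c, d)); simpl in Wa, Wb.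
  assert (near : forall s t x : R, Rabs x <= r -> Rabs t <= r -> Rabs (s - t) <= Rabs (x - t) ->
     Rabs s <= 3 * r).
  { intros s t x. unfold Rabs; repeat destruct Rcase_abs; lra. }
  assert (K1 := Cmod_variation (fun t => f (t, b)) (fun t => partial1 f (t, b)) L c a
    (fun t => is_derive_partial1 f t b Hf)).
  assert (K2 := Cmod_variation (fun t => f (c, t)) (fun t => partial2 f (c, t)) L d b
    (fun t => is_derive_partial2 f c t Hf)).
  assert (H1 : forall t, Rabs (t - c) <= Rabs (a - c) -> Cmod (partial1 f (t, b)) <= L).
  { intros t Ht. refine (proj1 (HL (t, b) _)). assert (T := Cmod_le_Re_Im (t, b)); simpl in T.
    assert (Rabs t <= 3 * r) by (apply (near t c a); lra). lra. }
  assert (H2 : forall t, Rabs (t - d) <= Rabs (b - d) -> Cmod (partial2 f (c, t)) <= L).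
  { intros t Ht. refine (proj2 (HL (c, t) _)). assert (T := Cmod_le_Re_Im (c, t)); simpl in T.
    assert (Rabs t <= 3 * r) by (apply (near t d b); lra). lra. }
  specialize (K1 H1); specialize (K2 H2).
  assert (T := Cmod_triangle (Cminus (f (a, b)) (f (c, b))) (Cminus (f (c, b)) (f (c, d)))).
  replace (Cplus _ _) with (Cminus (f (a, b)) (f (c, d))) in T by ring.
  assert (P1 := re_le_Cmod (Cminus (a, b) (c, d))); assert (P2 := im_le_Cmod (Cminus (a, b) (c, d))).
  simpl in P1, P2. fold (a - c) in P1. fold (b - d) in P2.
  assert (L0 : 0 <= 2 * L).
  { assert (Q := H1 c); rewrite Rminus_diag, Rabs_R0 in Q.
    assert (Q2 := Cmod_ge_0 (partial1 f (c, b))). specialize (Q (Rabs_pos _)). lra. }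
  assert (Q1 := Rmult_le_compat_l _ _ _ L0 P1).
  assert (Q2 := Rmult_le_compat_l _ _ _ L0 P2).
  lra.
Qed.

Lemma smooth2_lipschitz_ball (f : C -> C) (r : R) :
  smooth2 f ->
  exists L, forall z w, Cmod z <= r -> Cmod w <= r ->
    Cmod (Cminus (f z) (f w)) <= L * Cmod (Cminus z w).
Proof.
  intros Hf.
  destruct (smooth2_bounded_ball (partial1 f) (4 * r) (smooth2_partial1 f Hf)) as [M1 H1].
  destruct (smooth2_bounded_ball (partial2 f) (4 * r) (smooth2_partial2 f Hf)) as [M2 H2].
  exists (4 * Rmax M1 M2). apply smooth2_lipschitz; [exact Hf|].
  intros z Hz; split; eapply Rle_trans; [apply H1, Hz | apply Rmax_l | apply H2, Hz | apply Rmax_r].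
Qed.

(** * Nets with derivatives in a given class *)

Definition net_mult (u v : net) : net := fun e x => Cmult (u e x) (v e x).
Definition net_Re (u : net) : net := fun e x => RtoC (Re (u e x)).
Definition net_Im (u : net) : net := fun e x => RtoC (Im (u e x)).

Definition net_derive (u u' : net) : Prop :=
  forall e x, is_derive_in allR (u e) x (u' e x).

(** The derivative is given existentially, so a closure lemma can exhibit a formula for it without
    computing [derive_in]. The class [A] is a predicate on nets rather than on functions so that
    growth in [e] is covered as well. *)
Fixpoint derivs (n : nat) (A : net -> Prop) (u : net) : Prop :=
  A u /\
  match n with
  | O => True
  | S n' => exists u', net_derive u u' /\ derivs n' A u'
  end.

Definition smooth_net (A : net -> Prop) (u : net) : Prop := forall n, derivs n A u.

Lemma net_ext (u v : net) : (forall e x, u e x = v e x) -> u = v.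
Proof.
  intros H; apply functional_extensionality; intros e.
  apply functional_extensionality; intros x; apply H.
Qed.

Lemma net_derive_unique (u v w : net) : net_derive u v -> net_derive u w -> v = w.
Proof.
  intros H1 H2; apply net_ext; intros e x.
  exact (is_derive_in_unique allR (u e) x _ _ upward_allR I (H1 e x) (H2 e x)).
Qed.

Lemma derivs_0 (n : nat) (A : net -> Prop) (u : net) : derivs n A u -> A u.
Proof. destruct n; intros H; apply H. Qed.

Lemma derivs_pred (n : nat) (A : net -> Prop) (u : net) : derivs (S n) A u -> derivs n A u.
Proof.
  revert u; induction n as [|n IH]; intros u [Au [u' [Hu Hu']]]; split; try assumption; [exact I|].
  exists u'; split; [exact Hu | apply IH, Hu'].
Qed.

Lemma derivs_imp (n : nat) (A B : net -> Prop) (u : net) :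
  (forall v, A v -> B v) -> derivs n A u -> derivs n B u.
Proof.
  intros H; revert u; induction n as [|n IH]; intros u [Au Hu]; split; auto.
  destruct Hu as [u' [H1 H2]]; exists u'; auto.
Qed.

Lemma derivs_Re (n : nat) (A B : net -> Prop) (u : net) :
  (forall v, A v -> B (net_Re v)) -> derivs n A u -> derivs n B (net_Re u).
Proof.
  intros H; revert u; induction n as [|n IH]; intros u [Au Hu]; split; auto.
  destruct Hu as [u' [H1 H2]]; exists (net_Re u'); split; [|auto].
  intros e x; apply (is_derive_in_Re (u e)), H1.
Qed.

Lemma derivs_Im (n : nat) (A B : net -> Prop) (u : net) :
  (forall v, A v -> B (net_Im v)) -> derivs n A u -> derivs n B (net_Im u).
Proof.
  intros H; revert u; induction n as [|n IH]; intros u [Au Hu]; split; auto.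
  destruct Hu as [u' [H1 H2]]; exists (net_Im u'); split; [|auto].
  intros e x; apply (is_derive_in_Im (u e)), H1.
Qed.

Lemma derivs_plus (n : nat) (A B E : net -> Prop) (u v : net) :
  (forall f g, A f -> B g -> E (net_plus f g)) ->
  derivs n A u -> derivs n B v -> derivs n E (net_plus u v).
Proof.
  intros H; revert u v; induction n as [|n IH]; intros u v [Au Hu] [Bv Hv]; split; auto.
  destruct Hu as [u' [H1 H2]], Hv as [v' [H3 H4]].
  exists (net_plus u' v'); split; [|auto].
  intros e x; apply (is_derive_in_plus allR (u e) (v e)); auto.
Qed.

Lemma derivs_minus (n : nat) (A B E : net -> Prop) (u v : net) :
  (forall f g, A f -> B g -> E (net_minus f g)) ->
  derivs n A u -> derivs n B v -> derivs n E (net_minus u v).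
Proof.
  intros H; revert u v; induction n as [|n IH]; intros u v [Au Hu] [Bv Hv]; split; auto.
  destruct Hu as [u' [H1 H2]], Hv as [v' [H3 H4]].
  exists (net_minus u' v'); split; [|auto].
  intros e x; apply (is_derive_in_minus allR (u e) (v e)); auto.
Qed.

Lemma derivs_mult (n : nat) (A B E : net -> Prop) (u v : net) :
  (forall f g, A f -> B g -> E (net_mult f g)) ->
  (forall f g, E f -> E g -> E (net_plus f g)) ->
  derivs n A u -> derivs n B v -> derivs n E (net_mult u v).
Proof.
  intros HM HP; revert u v; induction n as [|n IH]; intros u v Hu Hv.
  - split; [apply HM; [apply Hu | apply Hv] | exact I].
  - assert (Pu := derivs_pred n A u Hu); assert (Pv := derivs_pred n B v Hv).
    destruct Hu as [Au [u' [H1 H2]]], Hv as [Bv [v' [H3 H4]]].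
    split; [auto|].
    exists (net_plus (net_mult u' v) (net_mult u v')); split.
    + intros e x; apply (is_derive_in_mult (u e) (v e)); auto.
    + apply (derivs_plus n E E); auto.
Qed.

Definition net_partial1 (f : net2) : net2 := fun e => partial1 (f e).
Definition net_partial2 (f : net2) : net2 := fun e => partial2 (f e).

Definition smooth_closed (S : net2 -> Prop) : Prop :=
  forall f, S f -> (forall e, smooth2 (f e)) /\ S (net_partial1 f) /\ S (net_partial2 f).

(** With [B] equal to [A] this is an algebra; with [B] negligible or vanishing it is the ideal
    property. Real and imaginary parts occur because the chain rule multiplies by [Re u'] and
    [Im u']. *)
Record module_over (A B : net -> Prop) : Prop := {
  module_Re : forall u, A u -> A (net_Re u);
  module_Im : forall u, A u -> A (net_Im u);
  module_plus : forall u v, B u -> B v -> B (net_plus u v);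
  module_mult : forall u v, B u -> A v -> B (net_mult u v) }.

Lemma net_derive_comp (f : net2) (u u' : net) :
  (forall e, smooth2 (f e)) -> net_derive u u' ->
  net_derive (net_comp f u)
    (net_plus (net_mult (net_comp (net_partial1 f) u) (net_Re u'))
              (net_mult (net_comp (net_partial2 f) u) (net_Im u'))).
Proof. intros Hf Hu e x; apply (is_derive_in_comp (f e) (u e)); auto. Qed.

(** [A] and [B] are kept apart for the case of a negligible [f]: then [u] is only moderate but the
    composition is negligible. In the chain rule the factor from [B] is a partial derivative of [f]
    along [u], to which the induction applies since [S] contains these partials. *)
Lemma derivs_comp (S : net2 -> Prop) (A B : net -> Prop) (n : nat) (f : net2) (u : net) :
  smooth_closed S -> module_over A B ->
  (forall g v, S g -> A v -> B (net_comp g v)) ->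
  S f -> derivs n A u -> derivs n B (net_comp f u).
Proof.
  intros HS [HR HI HP HM] HB; revert f u; induction n as [|n IH]; intros f u Sf Hu.
  - split; [apply HB; [exact Sf | apply Hu] | exact I].
  - assert (Pu := derivs_pred n A u Hu). destruct Hu as [Au [u' [H1 H2]]].
    destruct (HS f Sf) as [Hf [S1 S2]].
    split; [auto|]. eexists; split; [apply net_derive_comp; eassumption|].
    apply (derivs_plus n B B B); [exact HP| |].
    + apply (derivs_mult n B A B); auto. apply (derivs_Re n A A); auto.
    + apply (derivs_mult n B A B); auto. apply (derivs_Im n A A); auto.
Qed.

Lemma derivs_comp_minus (S : net2 -> Prop) (A N : net -> Prop) (n : nat) (f : net2) (u v : net) :
  smooth_closed S -> module_over A A -> module_over A N ->
  (forall w, N w -> N (net_Re w)) -> (forall w, N w -> N (net_Im w)) ->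
  (forall g w, S g -> A w -> A (net_comp g w)) ->
  (forall g w1 w2, S g -> A w1 -> A w2 -> N (net_minus w1 w2) ->
     N (net_minus (net_comp g w1) (net_comp g w2))) ->
  S f -> derivs n A u -> derivs n A v -> derivs n N (net_minus u v) ->
  derivs n N (net_minus (net_comp f u) (net_comp f v)).
Proof.
  intros HS HA HN NR NI HC HD; revert f u v; induction n as [|n IH]; intros f u v Sf Hu Hv Hw.
  - split; [apply HD; [exact Sf | apply Hu | apply Hv | apply Hw] | exact I].
  - assert (Pu := derivs_pred n A u Hu). assert (Pv := derivs_pred n A v Hv).
    assert (Pw := derivs_pred n N _ Hw).
    destruct Hu as [Au [u' [H1 H2]]], Hv as [Av [v' [H3 H4]]], Hw as [Nw [w' [H5 H6]]].
    (* The hypothesis on the difference supplies some derivative [w']; uniqueness ties it to [u']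
       and [v']. *)
    assert (E : w' = net_minus u' v').
    { apply (net_derive_unique _ _ _ H5).
      intros e x; apply (is_derive_in_minus allR (u e) (v e)); auto. }
    subst w'.
    destruct (HS f Sf) as [Hf [S1 S2]].
    split; [auto|].
    (* Each of the four products is written with its factor from [N] first, as [module_mult]
       expects. *)
    exists (net_plus
      (net_plus (net_mult (net_minus (net_comp (net_partial1 f) u) (net_comp (net_partial1 f) v)) (net_Re u'))
                (net_mult (net_Re (net_minus u' v')) (net_comp (net_partial1 f) v)))
      (net_plus (net_mult (net_minus (net_comp (net_partial2 f) u) (net_comp (net_partial2 f) v)) (net_Im u'))
                (net_mult (net_Im (net_minus u' v')) (net_comp (net_partial2 f) v)))).
    split.
    + assert (Q1 := net_derive_comp f u u' Hf H1). assert (Q2 := net_derive_comp f v v' Hf H3).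
      intros e x. assert (Q := is_derive_in_minus allR _ _ x _ _ (Q1 e x) (Q2 e x)).
      match type of Q with is_derive_in _ _ _ ?l => match goal with |- is_derive_in _ _ _ ?m =>
        replace m with l; [exact Q|] end end.
      unfold net_plus, net_mult, net_minus, net_Re, net_Im.
      replace (RtoC (Re (Cminus (u' e x) (v' e x)))) with (Cminus (RtoC (Re (u' e x))) (RtoC (Re (v' e x))))
        by (apply injective_projections; unfold Re; simpl; ring).
      replace (RtoC (Im (Cminus (u' e x) (v' e x)))) with (Cminus (RtoC (Im (u' e x))) (RtoC (Im (v' e x))))
        by (apply injective_projections; unfold Im; simpl; ring).
      ring.
    + assert (C1 := derivs_comp S A A n _ v HS HA HC S1 Pv).
      assert (C2 := derivs_comp S A A n _ v HS HA HC S2 Pv).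
      destruct HA as [HR HI _ _], HN as [_ _ NP NM].
      apply (derivs_plus n N N N); [exact NP| |]; (apply (derivs_plus n N N N); [exact NP| |]);
        (apply (derivs_mult n N A N); [exact NM | exact NP | |]); auto.
      * apply (derivs_Re n A A); auto.
      * apply (derivs_Re n N N); auto.
      * apply (derivs_Im n A A); auto.
      * apply (derivs_Im n N N); auto.
Qed.

Lemma derive_n_in_succ (D : R -> Prop) (n : nat) (f : R -> C) :
  derive_n_in D n (derive_in D f) = derive_n_in D (S n) f.
Proof. induction n; simpl in *; [reflexivity | rewrite IHn; reflexivity]. Qed.

Definition net_deriv (D : R -> Prop) (n : nat) (u : net) : net :=
  fun e => derive_n_in D n (u e).

Lemma smooth_net_derive (A : net -> Prop) (u : net) :
  smooth_net A u -> net_derive u (net_deriv allR 1 u) /\ smooth_net A (net_deriv allR 1 u).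
Proof.
  intros H.
  assert (Hu : net_derive u (net_deriv allR 1 u)).
  { destruct (H 1%nat) as [_ [u' [H1 _]]]; intros e x.
    apply (derive_in_correct allR (u e) x upward_allR I); eexists; apply H1. }
  split; [exact Hu|]. intros n.
  destruct (H (S n)) as [_ [u' [H1 H2]]].
  rewrite (net_derive_unique _ _ _ Hu H1); exact H2.
Qed.

(** Uniqueness identifies the existential derivatives with [derive_in]. The induction peels off the
    innermost derivative whereas [derive_n_in] adds the outermost one; [derive_n_in_succ] reconciles
    the two. *)
Lemma smooth_net_iff (A : net -> Prop) (u : net) :
  smooth_net A u <-> (forall e, smooth_in allR (u e)) /\ forall n, A (net_deriv allR n u).
Proof.
  split.
  - intros H.
    assert (K : forall n u, smooth_net A u ->
        A (net_deriv allR n u) /\ forall e x, ex_derive_in allR (derive_n_in allR n (u e)) x).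
    { clear u H; intros n; induction n as [|n IH]; intros u H.
      - split; [exact (derivs_0 0 A u (H 0%nat))|].
        intros e x; eexists; apply (proj1 (smooth_net_derive A u H)).
      - destruct (IH _ (proj2 (smooth_net_derive A u H))) as [K1 K2].
        unfold net_deriv in *; split.
        + replace (fun e => derive_n_in allR (S n) (u e))
            with (fun e => derive_n_in allR n (derive_n_in allR 1 (u e))); [exact K1|].
          apply functional_extensionality; intros e; apply derive_n_in_succ.
        + intros e x. rewrite <- derive_n_in_succ; apply K2. }
    split; [intros e n x _; apply (proj2 (K n u H)) | intros n; apply (proj1 (K n u H))].
  - intros [H1 H2] n; revert u H1 H2; induction n as [|n IH]; intros u H1 H2.
    + split; [exact (H2 0%nat) | exact I].
    + split; [exact (H2 0%nat)|].
      exists (net_deriv allR 1 u); split.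
      * intros e x; apply (derive_in_correct allR (u e) x upward_allR I), (H1 e 0%nat x I).
      * apply IH.
        -- intros e k x Hx. unfold net_deriv.
           change (derive_n_in allR 1 (u e)) with (derive_in allR (u e)).
           rewrite derive_n_in_succ; apply (H1 e (S k) x Hx).
        -- intros k. unfold net_deriv.
           replace (fun e => derive_n_in allR k (derive_n_in allR 1 (u e)))
             with (fun e => derive_n_in allR (S k) (u e)); [apply (H2 (S k))|].
           apply functional_extensionality; intros e; symmetry; apply derive_n_in_succ.
Qed.

(** * Almost automorphic and vanishing functions *)

(** Two arguments cover sum, difference and product; a dummy second argument covers real part,
    imaginary part and smooth functions. One closure proof per function space then gives all these
    operations. *)
Definition loclip2 (Phi : C -> C -> C) : Prop :=
  forall r, exists L, 0 <= L /\ forall z1 z2 w1 w2,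
    Cmod z1 <= r -> Cmod z2 <= r -> Cmod w1 <= r -> Cmod w2 <= r ->
    Cmod (Cminus (Phi z1 z2) (Phi w1 w2)) <= L * (Cmod (Cminus z1 w1) + Cmod (Cminus z2 w2)).

Lemma loclip2_plus : loclip2 Cplus.
Proof.
  intros r; exists 1; split; [lra|]; intros z1 z2 w1 w2 _ _ _ _.
  rewrite Rmult_1_l. replace (Cminus _ _) with (Cplus (Cminus z1 w1) (Cminus z2 w2)) by ring.
  apply Cmod_triangle.
Qed.

Lemma loclip2_minus : loclip2 Cminus.
Proof.
  intros r; exists 1; split; [lra|]; intros z1 z2 w1 w2 _ _ _ _.
  rewrite Rmult_1_l, <- (Cmod_opp (Cminus z2 w2)).
  replace (Cminus (Cminus z1 z2) _) with (Cplus (Cminus z1 w1) (Copp (Cminus z2 w2))) by ring.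
  apply Cmod_triangle.
Qed.

Lemma loclip2_mult : loclip2 Cmult.
Proof.
  intros r; exists (Rabs r); split; [apply Rabs_pos|]; intros z1 z2 w1 w2 H1 H2 H3 H4.
  replace (Cminus _ _) with (Cplus (Cmult (Cminus z1 w1) z2) (Cmult w1 (Cminus z2 w2))) by ring.
  eapply Rle_trans; [apply Cmod_triangle|]. rewrite !Cmod_mult.
  assert (Hr := Rle_abs r).
  assert (Q1 := Rmult_le_compat_l _ _ _ (Cmod_ge_0 (Cminus z1 w1)) (Rle_trans _ _ _ H2 Hr)).
  assert (Q2 := Rmult_le_compat_r _ _ _ (Cmod_ge_0 (Cminus z2 w2)) (Rle_trans _ _ _ H3 Hr)).
  lra.
Qed.

Lemma Cmod_Re_minus (z w : C) : Cmod (Cminus (RtoC (Re z)) (RtoC (Re w))) <= Cmod (Cminus z w).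
Proof. rewrite <- RtoC_minus, Cmod_R. apply (re_le_Cmod (Cminus z w)). Qed.

Lemma Cmod_Im_minus (z w : C) : Cmod (Cminus (RtoC (Im z)) (RtoC (Im w))) <= Cmod (Cminus z w).
Proof. rewrite <- RtoC_minus, Cmod_R. apply (im_le_Cmod (Cminus z w)). Qed.

Lemma loclip2_Re : loclip2 (fun z _ => RtoC (Re z)).
Proof.
  intros r; exists 1; split; [lra|]; intros z1 z2 w1 w2 _ _ _ _.
  assert (T := Cmod_Re_minus z1 w1). assert (T2 := Cmod_ge_0 (Cminus z2 w2)). lra.
Qed.

Lemma loclip2_Im : loclip2 (fun z _ => RtoC (Im z)).
Proof.
  intros r; exists 1; split; [lra|]; intros z1 z2 w1 w2 _ _ _ _.
  assert (T := Cmod_Im_minus z1 w1). assert (T2 := Cmod_ge_0 (Cminus z2 w2)). lra.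
Qed.

Lemma loclip2_smooth2 (f : C -> C) : smooth2 f -> loclip2 (fun z _ => f z).
Proof.
  intros Hf r. destruct (smooth2_lipschitz_ball f r Hf) as [L HL].
  exists (Rmax L 0); split; [apply Rmax_r|]; intros z1 z2 w1 w2 H1 _ H2 _.
  eapply Rle_trans; [apply HL; assumption|].
  assert (T1 := Cmod_ge_0 (Cminus z1 w1)). assert (T2 := Cmod_ge_0 (Cminus z2 w2)).
  assert (Q := Rmult_le_compat_r _ _ _ T1 (Rmax_l L 0)).
  assert (Q2 := Rmult_le_pos _ _ (Rmax_r L 0) T2). lra.
Qed.

Lemma filterlim_Cmod {T : Type} (F : (T -> Prop) -> Prop) (u : T -> C) (l : C) :
  Filter F ->
  filterlim u F (locally (T := C_UniformSpace) l) <->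
  forall eps, 0 < eps -> F (fun t => Cmod (Cminus (u t) l) < eps).
Proof.
  intros FF; rewrite (filterlim_locally (U := C_UniformSpace)); split.
  (* Balls of [C] are products of real balls, so half of [eps] is spent on each component. *)
  - intros H eps He. assert (He2 : 0 < eps / 2) by lra.
    generalize (H (mkposreal _ He2)); apply filter_imp; intros t [H1 H2].
    unfold ball in H1, H2; simpl in H1, H2; unfold AbsRing_ball, abs, minus, plus, opp in H1, H2;
      simpl in H1, H2.
    assert (Q := Cmod_le_Re_Im (Cminus (u t) l)); simpl in Q. lra.
  - intros H eps. generalize (H eps (cond_pos eps)); apply filter_imp; intros t Ht.
    assert (Q1 := re_le_Cmod (Cminus (u t) l)). assert (Q2 := im_le_Cmod (Cminus (u t) l)).
    simpl in Q1, Q2.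
    split; unfold ball; simpl; unfold AbsRing_ball, abs, minus, plus, opp; simpl;
      eapply Rle_lt_trans; try exact Ht; assumption.
Qed.

Lemma loclip2_filterlim {T : Type} (F : (T -> Prop) -> Prop) (Phi : C -> C -> C)
    (u v : T -> C) (l m : C) :
  Filter F -> loclip2 Phi ->
  filterlim u F (locally (T := C_UniformSpace) l) ->
  filterlim v F (locally (T := C_UniformSpace) m) ->
  filterlim (fun t => Phi (u t) (v t)) F (locally (T := C_UniformSpace) (Phi l m)).
Proof.
  intros FF HPhi. rewrite !filterlim_Cmod by exact FF. intros Hu Hv eps He.
  (* This ball contains both limits and, once the distances are below 1, also [u t] and [v t].
     Dividing by [L + 1] below keeps the case [L = 0] harmless. *)
  destruct (HPhi (Cmod l + Cmod m + 1)) as [L [HL0 HL]].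
  assert (Hd : 0 < Rmin 1 (eps / (2 * (L + 1)))).
  { apply Rmin_pos; [lra | apply Rdiv_lt_0_compat; lra]. }
  assert (Pl := Cmod_ge_0 l); assert (Pm := Cmod_ge_0 m).
  generalize (filter_and _ _ (Hu _ Hd) (Hv _ Hd)); apply filter_imp; intros t [H1 H2].
  assert (B1 := Rmin_l 1 (eps / (2 * (L + 1)))). assert (B2 := Rmin_r 1 (eps / (2 * (L + 1)))).
  set (d := Rmin _ _) in *.
  assert (T1 : Cmod (u t) <= Cmod l + 1).
  { replace (u t) with (Cplus l (Cminus (u t) l)) by ring.
    eapply Rle_trans; [apply Cmod_triangle|]; lra. }
  assert (T2 : Cmod (v t) <= Cmod m + 1).
  { replace (v t) with (Cplus m (Cminus (v t) m)) by ring.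
    eapply Rle_trans; [apply Cmod_triangle|]; lra. }
  eapply Rle_lt_trans; [apply HL; lra|].
  apply Rle_lt_trans with (L * (2 * (eps / (2 * (L + 1))))).
  - apply Rmult_le_compat_l; lra.
  - apply Rmult_lt_reg_r with (L + 1); [lra|].
    replace (L * (2 * (eps / (2 * (L + 1)))) * (L + 1)) with (L * eps) by (field; lra). nra.
Qed.

Definition lift2 (Phi : C -> C -> C) (f g : R -> C) : R -> C := fun x => Phi (f x) (g x).

Definition loclip_closed (X : (R -> C) -> Prop) : Prop :=
  forall Phi f g, loclip2 Phi -> X f -> X g -> X (lift2 Phi f g).

(** Values are compared with [Phi 0 0]; the [Rmax 0] in the radius puts the origin in the ball
    whatever the sign of [M1] and [M2]. *)
Lemma loclip_closed_bounded (D : R -> Prop) : loclip_closed (bounded_on D).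
Proof.
  intros Phi f g HPhi [M1 H1] [M2 H2].
  destruct (HPhi (Rmax 0 (Rmax M1 M2))) as [L [L0 HL]].
  set (r := Rmax 0 (Rmax M1 M2)) in *.
  assert (R0 : 0 <= r) by apply Rmax_l.
  assert (R1 : M1 <= r) by (eapply Rle_trans; [apply (Rmax_l M1 M2) | apply Rmax_r]).
  assert (R2 : M2 <= r) by (eapply Rle_trans; [apply (Rmax_r M1 M2) | apply Rmax_r]).
  exists (L * (r + r) + Cmod (Phi (RtoC 0) (RtoC 0))); intros x Dx; unfold lift2.
  specialize (H1 x Dx); specialize (H2 x Dx).
  assert (Q : Cmod (Cminus (Phi (f x) (g x)) (Phi (RtoC 0) (RtoC 0)))
     <= L * (Cmod (Cminus (f x) (RtoC 0)) + Cmod (Cminus (g x) (RtoC 0)))).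
  { apply HL; rewrite ?Cmod_0; lra. }
  replace (Cminus (f x) (RtoC 0)) with (f x) in Q by ring.
  replace (Cminus (g x) (RtoC 0)) with (g x) in Q by ring.
  assert (T := Cmod_triangle (Cminus (Phi (f x) (g x)) (Phi (RtoC 0) (RtoC 0))) (Phi (RtoC 0) (RtoC 0))).
  replace (Cplus _ _) with (Phi (f x) (g x)) in T by ring.
  assert (L * (Cmod (f x) + Cmod (g x)) <= L * (r + r)) by (apply Rmult_le_compat_l; lra).
  lra.
Qed.

Lemma loclip_closed_continuous : loclip_closed continuous_RC.
Proof.
  intros Phi f g HPhi Hf Hg x.
  apply (loclip2_filterlim (locally x) Phi f g); [apply locally_filter | exact HPhi | apply Hf | apply Hg].
Qed.

Lemma loclip_closed_C_b : loclip_closed C_b.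
Proof.
  intros Phi f g HPhi [F1 F2] [G1 G2]; split.
  - apply loclip_closed_continuous; assumption.
  - apply loclip_closed_bounded; assumption.
Qed.

Lemma extraction_ge (phi : nat -> nat) :
  (forall k, (phi k < phi (S k))%nat) -> forall n, (n <= phi n)%nat.
Proof. intros H n; induction n; [lia | specialize (H n); lia]. Qed.

Lemma extraction_mono (phi : nat -> nat) :
  (forall k, (phi k < phi (S k))%nat) -> forall m n, (m < n)%nat -> (phi m < phi n)%nat.
Proof.
  intros H m n Hmn; induction Hmn as [|n Hmn IH]; [apply H | specialize (H n); lia].
Qed.

Lemma seq_lim_extraction (u : nat -> C) (l : C) (phi : nat -> nat) :
  (forall k, (phi k < phi (S k))%nat) -> seq_lim u l -> seq_lim (fun k => u (phi k)) l.
Proof.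
  intros Hphi H. apply (filterlim_comp _ _ _ phi u eventually eventually); [|exact H].
  intros P [N HN]; exists N; intros n Hn; apply HN.
  assert (Q := extraction_ge phi Hphi n); lia.
Qed.

(** If [g] were unbounded, points [s m] with [Cmod (g (s m)) > m] would form a sequence of
    translations along which no subsequence converges at 0. *)
Lemma C_aa_bounded (g : R -> C) : C_aa g -> bounded_on allR g.
Proof.
  intros [_ H]. apply NNPP; intros HN.
  assert (Hs : forall m : nat, exists x, INR m < Cmod (g x)).
  { intros m; apply NNPP; intros Hm; apply HN; exists (INR m); intros x _.
    apply Rnot_lt_le; intros Hx; apply Hm; exists x; exact Hx. }
  set (s := fun m => proj1_sig (constructive_indefinite_description _ (Hs m))).
  assert (Hs' : forall m, INR m < Cmod (g (s m))).
  { intros m; exact (proj2_sig (constructive_indefinite_description _ (Hs m))). }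
  destruct (H s) as [phi [Hphi [gt [H1 _]]]].
  specialize (H1 0). unfold seq_lim in H1.
  rewrite filterlim_Cmod in H1 by apply eventually_filter.
  destruct (H1 1 Rlt_0_1) as [N HNN].
  destruct (nfloor_ex (Cmod (gt 0) + 1)) as [k [_ Hk]].
  { assert (Q := Cmod_ge_0 (gt 0)); lra. }
  (* The index must be late enough for [g (s (phi n))] to be within 1 of its limit, and [phi n] must
     exceed [k] so that the same value has modulus above [Cmod (gt 0) + 1]. *)
  set (n := max N (S k)).
  specialize (HNN n (Nat.le_max_l _ _)).
  assert (Hn : INR (S k) <= INR (phi n)).
  { apply le_INR. assert (Q := extraction_ge phi Hphi n). unfold n in *. lia. }
  rewrite S_INR in Hn. assert (Q := Hs' (phi n)).
  rewrite Rplus_0_l in HNN.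
  assert (T := Cmod_triangle (gt 0) (Cminus (g (s (phi n))) (gt 0))).
  replace (Cplus _ _) with (g (s (phi n))) in T by ring. lra.
Qed.

Lemma C_aa_C_b (g : R -> C) : C_aa g -> C_b g.
Proof. intros H; split; [apply H | apply C_aa_bounded, H]. Qed.

(** The subsequence for [g] is extracted from the one for [f], so the limits of [f] persist along
    it. Both limit conditions are pointwise, so a Lipschitz constant near the limits at each [x] is
    enough. *)
Lemma loclip_closed_C_aa : loclip_closed C_aa.
Proof.
  intros Phi f g HPhi [Cf Hf] [Cg Hg]; split; [apply loclip_closed_continuous; assumption|].
  intros s. destruct (Hf s) as [phi [Hphi [ft [F1 F2]]]].
  destruct (Hg (fun k => s (phi k))) as [psi [Hpsi [gt [G1 G2]]]].
  exists (fun k => phi (psi k)); split.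
  - intros k; apply extraction_mono; [exact Hphi | apply Hpsi].
  - exists (lift2 Phi ft gt); split; intros x.
    + apply (loclip2_filterlim eventually Phi); [apply eventually_filter | exact HPhi | | apply G1].
      apply (seq_lim_extraction (fun k => f (x + s (phi k))) (ft x) psi Hpsi (F1 x)).
    + apply (loclip2_filterlim eventually Phi); [apply eventually_filter | exact HPhi | | apply G2].
      apply (seq_lim_extraction (fun k => ft (x - s (phi k))) (f x) psi Hpsi (F2 x)).
Qed.

(** * Functions vanishing at infinity and asymptotic almost automorphy *)

Lemma tends_to_0_iff (f : R -> C) :
  tends_to_0_at_infty f <->
  forall eps, 0 < eps -> Rbar_locally p_infty (fun x => Cmod (f x) < eps).
Proof.
  unfold tends_to_0_at_infty.
  assert (FF : Filter (Rbar_locally p_infty)) by apply Rbar_locally_filter.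
  rewrite filterlim_Cmod by exact FF.
  split; intros H eps He; generalize (H eps He); apply filter_imp; intros x Hx;
    replace (Cminus (f x) (RtoC 0)) with (f x) in * by ring; exact Hx.
Qed.

Lemma tends_to_0_dominated (f g : R -> C) (M : R) :
  (forall x, Cmod (f x) <= M * Cmod (g x)) -> tends_to_0_at_infty g -> tends_to_0_at_infty f.
Proof.
  intros H. rewrite !tends_to_0_iff. intros Hg eps He.
  assert (Hd : 0 < eps / (Rabs M + 1)).
  { apply Rdiv_lt_0_compat; [exact He | assert (Q := Rabs_pos M); lra]. }
  assert (FF : Filter (Rbar_locally p_infty)) by apply Rbar_locally_filter.
  generalize (Hg _ Hd); apply filter_imp; intros x Hx.
  eapply Rle_lt_trans; [apply H|].
  assert (Q := Rabs_pos M). assert (Q2 := Rle_abs M). assert (P := Cmod_ge_0 (g x)).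
  apply Rle_lt_trans with ((Rabs M + 1) * Cmod (g x)); [nra|].
  apply Rlt_le_trans with ((Rabs M + 1) * (eps / (Rabs M + 1))).
  - apply Rmult_lt_compat_l; lra.
  - right; field; lra.
Qed.

Lemma tends_to_0_plus (f g : R -> C) :
  tends_to_0_at_infty f -> tends_to_0_at_infty g ->
  tends_to_0_at_infty (fun x => Cplus (f x) (g x)).
Proof.
  intros Hf Hg. unfold tends_to_0_at_infty. replace (RtoC 0) with (Cplus (RtoC 0) (RtoC 0)) by ring.
  apply loclip2_filterlim; [apply Rbar_locally_filter | apply loclip2_plus | exact Hf | exact Hg].
Qed.

(** Boundedness puts all values in one ball, hence one Lipschitz constant [L] for all [x]; the
    difference is dominated by [L] times a sum of two vanishing functions. *)
Lemma tends_to_0_lift2 (Phi : C -> C -> C) (f1 f2 h1 h2 : R -> C) :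
  loclip2 Phi -> bounded_on allR f1 -> bounded_on allR f2 ->
  bounded_on allR h1 -> bounded_on allR h2 ->
  tends_to_0_at_infty (lift2 Cminus f1 h1) -> tends_to_0_at_infty (lift2 Cminus f2 h2) ->
  tends_to_0_at_infty (lift2 Cminus (lift2 Phi f1 f2) (lift2 Phi h1 h2)).
Proof.
  intros HPhi [M1 B1] [M2 B2] [M3 B3] [M4 B4] T1 T2.
  destruct (HPhi (Rmax (Rmax M1 M2) (Rmax M3 M4))) as [L [L0 HL]].
  apply (tends_to_0_dominated _ (fun x => Cplus (RtoC (Cmod (lift2 Cminus f1 h1 x)))
     (RtoC (Cmod (lift2 Cminus f2 h2 x)))) L).
  - intros x. rewrite <- RtoC_plus, Cmod_R, Rabs_pos_eq.
    2: { assert (Q := Cmod_ge_0 (lift2 Cminus f1 h1 x)). assert (Q2 := Cmod_ge_0 (lift2 Cminus f2 h2 x)). lra. }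
    apply HL.
    + eapply Rle_trans; [apply (B1 x I) | eapply Rle_trans; [apply Rmax_l | apply Rmax_l]].
    + eapply Rle_trans; [apply (B2 x I) | eapply Rle_trans; [apply Rmax_r | apply Rmax_l]].
    + eapply Rle_trans; [apply (B3 x I) | eapply Rle_trans; [apply Rmax_l | apply Rmax_r]].
    + eapply Rle_trans; [apply (B4 x I) | eapply Rle_trans; [apply Rmax_r | apply Rmax_r]].
  - apply (tends_to_0_plus (fun x => RtoC (Cmod (lift2 Cminus f1 h1 x)))).
    + apply (tends_to_0_dominated _ (lift2 Cminus f1 h1) 1); [|exact T1].
      intros x; rewrite Cmod_R, Rabs_pos_eq by apply Cmod_ge_0; lra.
    + apply (tends_to_0_dominated _ (lift2 Cminus f2 h2) 1); [|exact T2].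
      intros x; rewrite Cmod_R, Rabs_pos_eq by apply Cmod_ge_0; lra.
Qed.

(** This is the decomposition of the theorem at order zero: principal part [Phi g1 g2], corrective
    part the increment of [Phi] from [g] to [g + h]. The increment uses [g + h] rather than [f]
    because the two are only known to agree on [J]. *)
Lemma loclip_closed_C_aaa : loclip_closed C_aaa.
Proof.
  intros Phi f1 f2 HPhi [F1 [g1 [h1 [G1 [[H1 T1] E1]]]]] [F2 [g2 [h2 [G2 [[H2 T2] E2]]]]].
  split; [apply loclip_closed_C_b; assumption|].
  assert (B1 := C_aa_C_b g1 G1). assert (B2 := C_aa_C_b g2 G2).
  assert (S1 := loclip_closed_C_b Cplus g1 h1 loclip2_plus B1 H1).
  assert (S2 := loclip_closed_C_b Cplus g2 h2 loclip2_plus B2 H2).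
  exists (lift2 Phi g1 g2),
    (lift2 Cminus (lift2 Phi (lift2 Cplus g1 h1) (lift2 Cplus g2 h2)) (lift2 Phi g1 g2)).
  split; [apply loclip_closed_C_aa; assumption|].
  split; [split|].
  - apply loclip_closed_C_b; [apply loclip2_minus | |]; apply loclip_closed_C_b; assumption.
  - apply tends_to_0_lift2; [exact HPhi | apply S1 | apply S2 | apply B1 | apply B2 | |].
    + apply (tends_to_0_dominated _ h1 1); [|exact T1]. intros x; right; rewrite Rmult_1_l.
      f_equal; unfold lift2; ring.
    + apply (tends_to_0_dominated _ h2 1); [|exact T2]. intros x; right; rewrite Rmult_1_l.
      f_equal; unfold lift2; ring.
  - intros x Jx. unfold lift2. rewrite <- E1, <- E2 by exact Jx. ring.
Qed.

Lemma B_aaa_B_on (f : R -> C) : B_aaa f -> B_on allR f.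
Proof. intros [H1 H2]; split; [exact H1 | intros n; apply (H2 n)]. Qed.

Lemma B_aa_B_on (f : R -> C) : B_aa f -> B_on allR f.
Proof. intros [H1 H2]; split; [exact H1 | intros n; apply C_aa_bounded, H2]. Qed.

Definition each (X : (R -> C) -> Prop) (u : net) : Prop := forall e, X (u e).

Lemma each_plus (X : (R -> C) -> Prop) (u v : net) :
  loclip_closed X -> each X u -> each X v -> each X (net_plus u v).
Proof. intros H Hu Hv e; apply (H Cplus (u e) (v e) loclip2_plus); auto. Qed.

Lemma each_minus (X : (R -> C) -> Prop) (u v : net) :
  loclip_closed X -> each X u -> each X v -> each X (net_minus u v).
Proof. intros H Hu Hv e; apply (H Cminus (u e) (v e) loclip2_minus); auto. Qed.

Lemma each_comp (X : (R -> C) -> Prop) (f : net2) (u : net) :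
  loclip_closed X -> (forall e, smooth2 (f e)) -> each X u -> each X (net_comp f u).
Proof.
  intros H Hf Hu e. exact (H (fun z _ => f e z) (u e) (u e) (loclip2_smooth2 _ (Hf e)) (Hu e) (Hu e)).
Qed.

Lemma each_module (X : (R -> C) -> Prop) : loclip_closed X -> module_over (each X) (each X).
Proof.
  intros H; split.
  - intros u Hu e. exact (H _ (u e) (u e) loclip2_Re (Hu e) (Hu e)).
  - intros u Hu e. exact (H _ (u e) (u e) loclip2_Im (Hu e) (Hu e)).
  - intros u v; apply each_plus, H.
  - intros u v Hu Hv e; apply (H Cmult (u e) (v e) loclip2_mult); auto.
Qed.

Lemma tends_to_0_module :
  module_over (each (bounded_on allR)) (each tends_to_0_at_infty).
Proof.
  destruct (each_module _ (loclip_closed_bounded allR)) as [HR HI _ _].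
  split; [exact HR | exact HI | |].
  - intros u v Hu Hv e; apply tends_to_0_plus; auto.
  - intros u v Hu Hv e. destruct (Hv e) as [M HM].
    apply (tends_to_0_dominated _ (u e) M); [|apply Hu].
    intros x; unfold net_mult. rewrite Cmod_mult, Rmult_comm.
    apply Rmult_le_compat_r; [apply Cmod_ge_0 | apply HM; exact I].
Qed.

(** * Moderate and negligible growth *)

Definition eventually0 (P : index -> Prop) : Prop :=
  exists e0, 0 < e0 /\ forall e : index, proj1_sig e < e0 -> P e.

Lemma eventually0_and (P Q : index -> Prop) :
  eventually0 P -> eventually0 Q -> eventually0 (fun e => P e /\ Q e).
Proof.
  intros [a [Ha HP]] [b [Hb HQ]]; exists (Rmin a b); split; [apply Rmin_pos; assumption|].
  intros e He; split; [apply HP | apply HQ];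
    eapply Rlt_le_trans; [exact He | apply Rmin_l | exact He | apply Rmin_r].
Qed.

Lemma eventually0_imp (P Q : index -> Prop) :
  (forall e, P e -> Q e) -> eventually0 P -> eventually0 Q.
Proof. intros H [a [Ha HP]]; exists a; auto. Qed.

(** The pointwise form of the O condition on sup norms, with a nonnegative constant, so that the
    estimates stay within the real numbers; [bigO_sup_norm] links the two forms. *)
Definition dominated (D : R -> Prop) (u : net) (b : R -> R) : Prop :=
  exists K, 0 <= K /\
    eventually0 (fun e => forall x, D x -> Cmod (u e x) <= K * b (proj1_sig e)).

Definition moderate0 (D : R -> Prop) (u : net) : Prop :=
  exists m, dominated D u (fun e => / e ^ m).

Definition negligible0 (D : R -> Prop) (u : net) : Prop :=
  forall m, dominated D u (fun e => e ^ m).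

Lemma index_pow_pos (e : index) (m : nat) : 0 < proj1_sig e ^ m.
Proof. apply pow_lt, (proj2_sig e). Qed.

Lemma index_inv_pow_pos (e : index) (m : nat) : 0 < / proj1_sig e ^ m.
Proof. apply Rinv_0_lt_compat, index_pow_pos. Qed.

(** Since [e <= 1], exponents of moderate bounds may be enlarged, which brings two such bounds to a
    common exponent. *)
Lemma index_inv_pow_le (e : index) (m n : nat) :
  (m <= n)%nat -> / proj1_sig e ^ m <= / proj1_sig e ^ n.
Proof.
  intros H. apply Rinv_le_contravar; [apply index_pow_pos|].
  replace n with (m + (n - m))%nat by lia. rewrite pow_add.
  rewrite <- (Rmult_1_r (proj1_sig e ^ m)) at 2.
  apply Rmult_le_compat_l; [left; apply index_pow_pos|].
  destruct (proj2_sig e) as [H0 H1].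
  rewrite <- (pow1 (n - m)). apply pow_incr; lra.
Qed.

Lemma index_inv_pow_ge_1 (e : index) (m : nat) : 1 <= / proj1_sig e ^ m.
Proof. assert (H := index_inv_pow_le e 0 m ltac:(lia)); simpl in H; rewrite Rinv_1 in H; exact H. Qed.

Lemma dominated_le (D : R -> Prop) (u v : net) (b c : R -> R) :
  (forall e x, D x -> Cmod (u e x) <= Cmod (v e x)) ->
  (forall e : index, b (proj1_sig e) <= c (proj1_sig e)) ->
  dominated D v b -> dominated D u c.
Proof.
  intros H Hbc [K [K0 HK]]; exists K; split; [exact K0|]; revert HK; apply eventually0_imp.
  intros e He x Dx. eapply Rle_trans; [apply H, Dx|]. eapply Rle_trans; [apply He, Dx|].
  apply Rmult_le_compat_l; auto.
Qed.

Lemma dominated_add (D : R -> Prop) (u v w : net) (b : R -> R) :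
  (forall e x, Cmod (w e x) <= Cmod (u e x) + Cmod (v e x)) ->
  dominated D u b -> dominated D v b -> dominated D w b.
Proof.
  intros H [K [K0 HK]] [L [L0 HL]]; exists (K + L); split; [lra|].
  generalize (eventually0_and _ _ HK HL); apply eventually0_imp.
  intros e [H1 H2] x Dx. specialize (H1 x Dx); specialize (H2 x Dx). specialize (H e x). lra.
Qed.

Lemma moderate0_le (D : R -> Prop) (u : net) (m n : nat) :
  (m <= n)%nat -> dominated D u (fun e => / e ^ m) -> dominated D u (fun e => / e ^ n).
Proof.
  intros H; apply dominated_le; [intros; lra|]. intros e; apply index_inv_pow_le, H.
Qed.

Lemma moderate0_add (D : R -> Prop) (u v w : net) :
  (forall e x, Cmod (w e x) <= Cmod (u e x) + Cmod (v e x)) ->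
  moderate0 D u -> moderate0 D v -> moderate0 D w.
Proof.
  intros H [m Hm] [n Hn]; exists (m + n)%nat; apply (dominated_add D u v w _ H).
  - apply (moderate0_le D u m); [lia | exact Hm].
  - apply (moderate0_le D v n); [lia | exact Hn].
Qed.

Lemma negligible0_add (D : R -> Prop) (u v w : net) :
  (forall e x, Cmod (w e x) <= Cmod (u e x) + Cmod (v e x)) ->
  negligible0 D u -> negligible0 D v -> negligible0 D w.
Proof. intros H Hu Hv m; apply (dominated_add D u v w _ H); auto. Qed.

Lemma Cmod_plus_le (z w : C) : Cmod (Cplus z w) <= Cmod z + Cmod w.
Proof. apply Cmod_triangle. Qed.

Lemma Cmod_minus_le (z w : C) : Cmod (Cminus z w) <= Cmod z + Cmod w.
Proof. rewrite <- (Cmod_opp w); apply Cmod_triangle. Qed.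

Lemma Cmod_Re_le (z : C) : Cmod (RtoC (Re z)) <= Cmod z.
Proof. rewrite Cmod_R; apply re_le_Cmod. Qed.

Lemma Cmod_Im_le (z : C) : Cmod (RtoC (Im z)) <= Cmod z.
Proof. rewrite Cmod_R; apply im_le_Cmod. Qed.

Lemma moderate0_Re (D : R -> Prop) (u : net) : moderate0 D u -> moderate0 D (net_Re u).
Proof.
  intros [m Hm]; exists m; revert Hm; apply dominated_le; [intros; apply Cmod_Re_le | intros; lra].
Qed.

Lemma moderate0_Im (D : R -> Prop) (u : net) : moderate0 D u -> moderate0 D (net_Im u).
Proof.
  intros [m Hm]; exists m; revert Hm; apply dominated_le; [intros; apply Cmod_Im_le | intros; lra].
Qed.

Lemma negligible0_Re (D : R -> Prop) (u : net) : negligible0 D u -> negligible0 D (net_Re u).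
Proof.
  intros H m; generalize (H m); apply dominated_le; [intros; apply Cmod_Re_le | intros; lra].
Qed.

Lemma negligible0_Im (D : R -> Prop) (u : net) : negligible0 D u -> negligible0 D (net_Im u).
Proof.
  intros H m; generalize (H m); apply dominated_le; [intros; apply Cmod_Im_le | intros; lra].
Qed.

Lemma moderate0_module (D : R -> Prop) : module_over (moderate0 D) (moderate0 D).
Proof.
  split; [apply moderate0_Re | apply moderate0_Im | |].
  - intros u v; apply moderate0_add; intros; apply Cmod_plus_le.
  - intros u v [m [K [K0 HK]]] [n [L [L0 HL]]]; exists (m + n)%nat, (K * L).
    split; [apply Rmult_le_pos; assumption|].
    generalize (eventually0_and _ _ HK HL); apply eventually0_imp.
    intros e [H1 H2] x Dx; unfold net_mult; rewrite Cmod_mult, pow_add, Rinv_mult.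
    replace (K * L * (/ proj1_sig e ^ m * / proj1_sig e ^ n))
      with ((K * / proj1_sig e ^ m) * (L * / proj1_sig e ^ n)) by ring.
    apply Rmult_le_compat; try apply Cmod_ge_0; auto.
Qed.

(** A loss of [p] powers of [e] is compensated by using the negligibility of [u] at order [m + p].
    Products with moderate nets and Lipschitz estimates both take this form. *)
Lemma negligible0_scaled (D : R -> Prop) (u w : net) (p : nat) (K : R) :
  0 <= K ->
  eventually0 (fun e => forall x, D x -> Cmod (w e x) <= K * / proj1_sig e ^ p * Cmod (u e x)) ->
  negligible0 D u -> negligible0 D w.
Proof.
  intros K0 HK Hu m. destruct (Hu (m + p)%nat) as [L [L0 HL]]. exists (K * L).
  split; [apply Rmult_le_pos; assumption|].
  generalize (eventually0_and _ _ HK HL); apply eventually0_imp.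
  intros e [H1 H2] x Dx. eapply Rle_trans; [apply H1, Dx|].
  assert (P := index_inv_pow_pos e p).
  eapply Rle_trans; [apply Rmult_le_compat_l; [|apply H2, Dx]|].
  - apply Rmult_le_pos; lra.
  - right; rewrite pow_add. field. apply Rgt_not_eq, index_pow_pos.
Qed.

Lemma negligible0_module (D : R -> Prop) : module_over (moderate0 D) (negligible0 D).
Proof.
  split; [apply moderate0_Re | apply moderate0_Im | |].
  - intros u v; apply negligible0_add; intros; apply Cmod_plus_le.
  - intros u v Hu [p [K [K0 HK]]]; apply (negligible0_scaled D u _ p K K0); [|exact Hu].
    revert HK; apply eventually0_imp; intros e He x Dx; unfold net_mult.
    rewrite Cmod_mult, Rmult_comm.
    apply Rmult_le_compat_r; [apply Cmod_ge_0 | auto].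
Qed.

(** * From suprema in the extended reals to pointwise bounds *)

Lemma sup_over_le {T : Type} (D : T -> Prop) (h : T -> R) (M : R) :
  (exists x, D x) -> (forall x, D x -> 0 <= h x) ->
  Rbar_le (Rbar_abs (sup_over D h)) M <-> forall x, D x -> h x <= M.
Proof.
  intros [x0 D0] Hpos. unfold sup_over.
  set (E := fun y => exists x, D x /\ y = h x).
  destruct (Lub_Rbar_correct E) as [Hub Hl].
  (* A point of [D] with a nonnegative value excludes a supremum equal to minus infinity and makes
     the absolute value harmless. *)
  assert (H0 : Rbar_le (h x0) (Lub_Rbar E)) by (apply Hub; exists x0; auto).
  assert (P0 := Hpos x0 D0).
  split.
  - intros H x Dx. assert (H1 : Rbar_le (h x) (Lub_Rbar E)) by (apply Hub; exists x; auto).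
    destruct (Lub_Rbar E) as [r| |]; simpl in *; try easy.
    assert (Q := Rle_abs r); lra.
  - intros H. assert (H1 : Rbar_le (Lub_Rbar E) M).
    { apply Hl; intros y [x [Dx ->]]; exact (H x Dx). }
    destruct (Lub_Rbar E) as [r| |]; simpl in *; try easy.
    rewrite Rabs_pos_eq; lra.
Qed.

Lemma sup_over_pos {T : Type} (D : T -> Prop) (h : T -> R) :
  (exists x, D x) -> (forall x, D x -> 0 <= h x) -> Rbar_le 0 (sup_over D h).
Proof.
  intros [x0 D0] Hpos. destruct (Lub_Rbar_correct (fun y => exists x, D x /\ y = h x)) as [Hub _].
  eapply Rbar_le_trans; [|apply Hub; exists x0; split; [exact D0 | reflexivity]].
  exact (Hpos x0 D0).
Qed.

Lemma Rbar_abs_plus_le (a b : Rbar) (M : R) :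
  Rbar_le 0 a -> Rbar_le 0 b -> Rbar_le (Rbar_abs (Rbar_plus a b)) M ->
  Rbar_le (Rbar_abs a) M /\ Rbar_le (Rbar_abs b) M.
Proof.
  destruct a as [a| |], b as [b| |]; simpl; try easy. intros Ha Hb.
  rewrite !Rabs_pos_eq by lra. lra.
Qed.

Lemma Rbar_abs_plus_add (a b : Rbar) (M N : R) :
  Rbar_le (Rbar_abs a) M -> Rbar_le (Rbar_abs b) N ->
  Rbar_le (Rbar_abs (Rbar_plus a b)) (M + N).
Proof.
  destruct a as [a| |], b as [b| |]; simpl; try easy. intros Ha Hb.
  assert (T := Rabs_triang a b); lra.
Qed.

Lemma Ck_norm_pos (D : R -> Prop) (k : nat) (f : R -> C) :
  (exists x, D x) -> Rbar_le 0 (Ck_norm D k f).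
Proof.
  intros HD. assert (S : forall g, Rbar_le 0 (sup_norm D g)).
  { intros g; apply sup_over_pos; [exact HD | intros; apply Cmod_ge_0]. }
  induction k as [|k IH]; simpl; [apply S|].
  assert (Q := S (derive_in D (derive_n_in D k f))).
  destruct (Ck_norm D k f) as [a| |], (sup_norm D _) as [b| |]; simpl in *; try easy. lra.
Qed.

Lemma bigO_sup_norm (D : R -> Prop) (u : net) (b : R -> R) :
  (exists x, D x) -> (forall e : index, 0 <= b (proj1_sig e)) ->
  bigO (fun e => sup_norm D (u e)) b <-> dominated D u b.
Proof.
  intros HD Hb. split.
  - intros [K [e0 [He0 HK]]]. exists (Rabs K); split; [apply Rabs_pos|].
    exists e0; split; [exact He0|]. intros e He x Dx.
    specialize (HK e He). unfold sup_norm in HK.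
    apply (sup_over_le D (fun x => Cmod (u e x))) with (x := x) in HK; auto.
    + rewrite Rabs_pos_eq in HK by apply Hb. eapply Rle_trans; [exact HK|].
      apply Rmult_le_compat_r; [apply Hb | apply Rle_abs].
    + intros; apply Cmod_ge_0.
  - intros [K [K0 [e0 [He0 HK]]]]. exists K, e0; split; [exact He0|]. intros e He.
    apply (sup_over_le D (fun x => Cmod (u e x))); auto.
    + intros; apply Cmod_ge_0.
    + rewrite Rabs_pos_eq by apply Hb. auto.
Qed.

(** The norm is a sum of nonnegative terms, so a bound on it bounds every term; conversely the
    constants add up and the thresholds are replaced by their minimum. *)
Lemma bigO_Ck_norm (D : R -> Prop) (k : nat) (u : net) (b : R -> R) :
  (exists x, D x) -> (forall e : index, 0 <= b (proj1_sig e)) ->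
  bigO (fun e => Ck_norm D k (u e)) b <->
  forall j, (j <= k)%nat -> dominated D (net_deriv D j u) b.
Proof.
  intros HD Hb. induction k as [|k IH].
  - split.
    + intros H j Hj. replace j with 0%nat by lia. apply (bigO_sup_norm D); assumption.
    + intros H. apply (bigO_sup_norm D); auto. apply (H 0%nat); lia.
  - split.
    + intros [K [e0 [He0 HK]]].
      assert (Hs : forall e : index, proj1_sig e < e0 ->
        Rbar_le (Rbar_abs (Ck_norm D k (u e))) (K * Rabs (b (proj1_sig e))) /\
        Rbar_le (Rbar_abs (sup_norm D (derive_n_in D (S k) (u e)))) (K * Rabs (b (proj1_sig e)))).
      { intros e He; apply Rbar_abs_plus_le; [apply Ck_norm_pos, HD | | apply HK, He].
        apply sup_over_pos; [exact HD | intros; apply Cmod_ge_0]. }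
      intros j Hj. destruct (Nat.eq_dec j (S k)) as [-> | Hn].
      * apply bigO_sup_norm; auto. exists K, e0; split; [exact He0 | apply Hs].
      * apply IH; [|lia]. exists K, e0; split; [exact He0 | apply Hs].
    + intros H. destruct (proj2 IH) as [K [e0 [He0 HK]]]; [intros; apply H; lia|].
      destruct (proj2 (bigO_sup_norm D (net_deriv D (S k) u) b HD Hb) (H (S k) (le_n _)))
        as [L [e1 [He1 HL]]].
      exists (K + L), (Rmin e0 e1); split; [apply Rmin_pos; assumption|].
      intros e He. simpl Ck_norm. rewrite Rmult_plus_distr_r.
      apply Rbar_abs_plus_add; [apply HK | apply HL];
        eapply Rlt_le_trans; [exact He | apply Rmin_l | exact He | apply Rmin_r].
Qed.

Lemma negligible_iff (D : R -> Prop) (X : (R -> C) -> Prop) (u : net) :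
  (exists x, D x) ->
  negligible D X u <-> each X u /\ forall n, negligible0 D (net_deriv D n u).
Proof.
  intros HD. split.
  - intros [H1 H2]; split; [exact H1|]. intros n m.
    apply (proj1 (bigO_Ck_norm D n u (fun e => e ^ m) HD
      (fun e => Rlt_le _ _ (index_pow_pos e m))) (H2 n m)). lia.
  - intros [H1 H2]; split; [exact H1|]. intros k m.
    apply bigO_Ck_norm; [exact HD | intros e; left; apply index_pow_pos|]. intros j _; apply H2.
Qed.

Lemma moderate_iff (D : R -> Prop) (X : (R -> C) -> Prop) (u : net) :
  (exists x, D x) ->
  moderate D X u <-> each X u /\ forall n, moderate0 D (net_deriv D n u).
Proof.
  intros HD. split.
  - intros [H1 H2]; split; [exact H1|]. intros n. destruct (H2 n) as [m Hm]; exists m.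
    apply (proj1 (bigO_Ck_norm D n u (fun e => / e ^ m) HD
      (fun e => Rlt_le _ _ (index_inv_pow_pos e m))) Hm). lia.
  - intros [H1 H2]; split; [exact H1|]. intros k.
    assert (H : exists m, forall j, (j <= k)%nat -> dominated D (net_deriv D j u) (fun e => / e ^ m)).
    { induction k as [|k [m IH]].
      - destruct (H2 0%nat) as [m Hm]; exists m; intros j Hj; replace j with 0%nat by lia; exact Hm.
      (* The sum of the two exponents exceeds both and so serves all derivatives up to the new
         order. *)
      - destruct (H2 (S k)) as [n Hn]; exists (m + n)%nat; intros j Hj.
        destruct (Nat.eq_dec j (S k)) as [-> | Hne].
        + apply (moderate0_le D _ n); [lia | exact Hn].
        + apply (moderate0_le D _ m); [lia | apply IH; lia]. }
    destruct H as [m Hm]; exists m.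
    apply bigO_Ck_norm; [exact HD | intros e; left; apply index_inv_pow_pos | exact Hm].
Qed.

(** * Growth of tempered nets and of their compositions at order zero *)

Definition moderate_growth (f : net2) : Prop :=
  exists m K, 0 <= K /\
    eventually0 (fun e => forall z, Cmod (f e z) <= K * / proj1_sig e ^ m * (1 + Cmod z) ^ m).

Definition negligible_growth (f : net2) : Prop :=
  exists n, forall m, exists K, 0 <= K /\
    eventually0 (fun e => forall z, Cmod (f e z) <= K * proj1_sig e ^ m * (1 + Cmod z) ^ n).

Lemma bigO_weighted_sup (n : nat) (f : net2) (b : R -> R) :
  (forall e : index, 0 <= b (proj1_sig e)) ->
  bigO (fun e => weighted_sup n (f e)) b <->
  exists K, 0 <= K /\
    eventually0 (fun e => forall z, Cmod (f e z) <= K * b (proj1_sig e) * (1 + Cmod z) ^ n).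
Proof.
  intros Hb.
  assert (W : forall z : C, 0 < (1 + Cmod z) ^ n).
  { intros z; apply pow_lt; assert (Q := Cmod_ge_0 z); lra. }
  assert (Pos : forall (e : index) (z : C), True -> 0 <= / (1 + Cmod z) ^ n * Cmod (f e z)).
  { intros e z _; apply Rmult_le_pos; [left; apply Rinv_0_lt_compat, W | apply Cmod_ge_0]. }
  split.
  - intros [K [e0 [He0 HK]]]. exists (Rabs K); split; [apply Rabs_pos|].
    exists e0; split; [exact He0|]; intros e He z. specialize (HK e He).
    apply (sup_over_le (fun _ => True) _ _ (ex_intro _ (RtoC 0) I) (Pos e)) with (x := z) in HK; [|exact I].
    rewrite Rabs_pos_eq in HK by apply Hb.
    apply Rmult_le_reg_l with (/ (1 + Cmod z) ^ n); [apply Rinv_0_lt_compat, W|].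
    eapply Rle_trans; [exact HK|].
    replace (/ (1 + Cmod z) ^ n * (Rabs K * b (proj1_sig e) * (1 + Cmod z) ^ n))
      with (Rabs K * b (proj1_sig e)) by (field; apply Rgt_not_eq, W).
    apply Rmult_le_compat_r; [apply Hb | apply Rle_abs].
  - intros [K [K0 [e0 [He0 HK]]]]. exists K, e0; split; [exact He0|]; intros e He.
    apply (sup_over_le (fun _ => True) _ _ (ex_intro _ (RtoC 0) I) (Pos e)).
    intros z _. rewrite Rabs_pos_eq by apply Hb.
    apply Rmult_le_reg_l with ((1 + Cmod z) ^ n); [apply W|].
    replace ((1 + Cmod z) ^ n * (/ (1 + Cmod z) ^ n * Cmod (f e z))) with (Cmod (f e z))
      by (field; apply Rgt_not_eq, W).
    rewrite (Rmult_comm ((1 + Cmod z) ^ n)); apply HK, He.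
Qed.

Lemma moderate_tau_iff (f : net2) :
  moderate_tau f <-> (forall e, smooth2 (f e)) /\
    forall j1 j2, moderate_growth (fun e => partial_n j1 j2 (f e)).
Proof.
  split; intros [H1 H2]; (split; [exact H1|]); intros j1 j2; destruct (H2 j1 j2) as [m Hm]; exists m;
    apply (bigO_weighted_sup m (fun e => partial_n j1 j2 (f e)) (fun e => / e ^ m)); try exact Hm;
    intros e; left; apply index_inv_pow_pos.
Qed.

Lemma negligible_tau_iff (f : net2) :
  negligible_tau f <-> (forall e, smooth2 (f e)) /\
    forall j1 j2, negligible_growth (fun e => partial_n j1 j2 (f e)).
Proof.
  split; intros [H1 H2]; (split; [exact H1|]); intros j1 j2; destruct (H2 j1 j2) as [n Hn]; exists n;
    intros m; apply (bigO_weighted_sup n (fun e => partial_n j1 j2 (f e)) (fun e => e ^ m)); try exact (Hn m);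
    intros e; left; apply index_pow_pos.
Qed.

Lemma moderate_tau_closed : smooth_closed moderate_tau.
Proof.
  intros f [H1 H2]; split; [exact H1|].
  split; split.
  - intros e; apply smooth2_partial1, H1.
  - intros j1 j2. destruct (H2 (S j1) j2) as [m Hm]; exists m.
    replace (fun e => weighted_sup m (partial_n j1 j2 (net_partial1 f e)))
      with (fun e => weighted_sup m (partial_n (S j1) j2 (f e))); [exact Hm|].
    apply functional_extensionality; intros e; unfold net_partial1.
    rewrite partial_n_partial1; [reflexivity | apply H1].
  - intros e; apply smooth2_partial2, H1.
  - intros j1 j2. destruct (H2 j1 (S j2)) as [m Hm]; exists m.
    replace (fun e => weighted_sup m (partial_n j1 j2 (net_partial2 f e)))
      with (fun e => weighted_sup m (partial_n j1 (S j2) (f e))); [exact Hm|].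
    apply functional_extensionality; intros e; unfold net_partial2.
    rewrite partial_n_partial2; reflexivity.
Qed.

Lemma negligible_tau_closed : smooth_closed negligible_tau.
Proof.
  intros f [H1 H2]; split; [exact H1|].
  split; split.
  - intros e; apply smooth2_partial1, H1.
  - intros j1 j2. destruct (H2 (S j1) j2) as [n Hn]; exists n; intros m.
    replace (fun e => weighted_sup n (partial_n j1 j2 (net_partial1 f e)))
      with (fun e => weighted_sup n (partial_n (S j1) j2 (f e))); [apply Hn|].
    apply functional_extensionality; intros e; unfold net_partial1.
    rewrite partial_n_partial1; [reflexivity | apply H1].
  - intros e; apply smooth2_partial2, H1.
  - intros j1 j2. destruct (H2 j1 (S j2)) as [n Hn]; exists n; intros m.
    replace (fun e => weighted_sup n (partial_n j1 j2 (net_partial2 f e)))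
      with (fun e => weighted_sup n (partial_n j1 (S j2) (f e))); [apply Hn|].
    apply functional_extensionality; intros e; unfold net_partial2.
    rewrite partial_n_partial2; reflexivity.
Qed.

Lemma moderate_tau_growth (f : net2) : moderate_tau f -> moderate_growth f.
Proof. intros H; apply (proj2 (proj1 (moderate_tau_iff f) H) 0%nat 0%nat). Qed.

Lemma negligible_tau_growth (f : net2) : negligible_tau f -> negligible_growth f.
Proof. intros H; apply (proj2 (proj1 (negligible_tau_iff f) H) 0%nat 0%nat). Qed.

(** As [/ e ^ p] is at least 1, it also absorbs the constant 1 of the weight: [1 + Cmod z] is at
    most [(1 + K) * / e ^ p]. *)
Lemma weight_le (e : index) (z : C) (K : R) (p m : nat) :
  0 <= K -> Cmod z <= K * / proj1_sig e ^ p ->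
  (1 + Cmod z) ^ m <= (1 + K) ^ m * / proj1_sig e ^ (p * m).
Proof.
  intros K0 H. rewrite pow_mult, <- pow_inv, <- Rpow_mult_distr.
  assert (Q := Cmod_ge_0 z). assert (P := index_inv_pow_ge_1 e p).
  apply pow_incr; split; [lra|]. rewrite Rmult_plus_distr_r. lra.
Qed.

Lemma growth_bound (A K a w W : R) :
  0 <= A -> 0 <= K -> a <= K * A * w -> w <= W -> a <= K * A * W.
Proof.
  intros HA HK H1 H2. eapply Rle_trans; [exact H1|].
  apply Rmult_le_compat_l; [apply Rmult_le_pos; assumption | exact H2].
Qed.

(** The exponent [m + p * m] adds the growth of [f] in [e] to that of the weight of degree [m] at
    points of size [/ e ^ p]. *)
Lemma moderate0_comp (D : R -> Prop) (f : net2) (u : net) :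
  moderate_tau f -> moderate0 D u -> moderate0 D (net_comp f u).
Proof.
  intros Hf [p [K [K0 HK]]]. destruct (moderate_tau_growth f Hf) as [m [L [L0 HL]]].
  exists (m + p * m)%nat, (L * (1 + K) ^ m).
  split; [apply Rmult_le_pos; [exact L0 | apply pow_le; lra]|].
  generalize (eventually0_and _ _ HK HL); apply eventually0_imp; intros e [H1 H2] x Dx.
  unfold net_comp. rewrite pow_add, Rinv_mult.
  replace (L * (1 + K) ^ m * (/ proj1_sig e ^ m * / proj1_sig e ^ (p * m)))
    with (L * / proj1_sig e ^ m * ((1 + K) ^ m * / proj1_sig e ^ (p * m))) by ring.
  apply (growth_bound _ _ _ ((1 + Cmod (u e x)) ^ m)); auto.
  - left; apply index_inv_pow_pos.
  - apply weight_le; auto.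
Qed.

(** The degree [n] of the weight is fixed before the order of decay is chosen, so the loss
    [/ e ^ (p * n)] is known in advance and is met by asking for decay of order [q + p * n]. *)
Lemma negligible0_comp (D : R -> Prop) (f : net2) (u : net) :
  negligible_tau f -> moderate0 D u -> negligible0 D (net_comp f u).
Proof.
  intros Hf [p [K [K0 HK]]] q. destruct (negligible_tau_growth f Hf) as [n Hn].
  destruct (Hn (q + p * n)%nat) as [L [L0 HL]].
  exists (L * (1 + K) ^ n).
  split; [apply Rmult_le_pos; [exact L0 | apply pow_le; lra]|].
  generalize (eventually0_and _ _ HK HL); apply eventually0_imp; intros e [H1 H2] x Dx.
  unfold net_comp.
  replace (L * (1 + K) ^ n * proj1_sig e ^ q)
    with (L * proj1_sig e ^ (q + p * n) * ((1 + K) ^ n * / proj1_sig e ^ (p * n))).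
  2: { rewrite pow_add; field; apply Rgt_not_eq, index_pow_pos. }
  apply (growth_bound _ _ _ ((1 + Cmod (u e x)) ^ n)); auto.
  - left; apply index_pow_pos.
  - apply weight_le; auto.
Qed.

(** The Lipschitz estimate needs the partial derivatives on a full ball, beyond the values taken by
    the nets. *)
Lemma moderate_growth_ball (f : net2) (p : nat) (K : R) :
  moderate_growth f -> 0 <= K ->
  exists q L, 0 <= L /\ eventually0 (fun e => forall z,
    Cmod z <= K * / proj1_sig e ^ p -> Cmod (f e z) <= L * / proj1_sig e ^ q).
Proof.
  intros [m [L [L0 HL]]] K0. exists (m + p * m)%nat, (L * (1 + K) ^ m).
  split; [apply Rmult_le_pos; [exact L0 | apply pow_le; lra]|].
  revert HL; apply eventually0_imp; intros e H2 z Hz.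
  rewrite pow_add, Rinv_mult.
  replace (L * (1 + K) ^ m * (/ proj1_sig e ^ m * / proj1_sig e ^ (p * m)))
    with (L * / proj1_sig e ^ m * ((1 + K) ^ m * / proj1_sig e ^ (p * m))) by ring.
  apply (growth_bound _ _ _ ((1 + Cmod z) ^ m)); auto.
  - left; apply index_inv_pow_pos.
  - apply weight_le; auto.
Qed.

Lemma negligible0_comp_minus (D : R -> Prop) (f : net2) (u v : net) :
  moderate_tau f -> moderate0 D u -> moderate0 D v -> negligible0 D (net_minus u v) ->
  negligible0 D (net_minus (net_comp f u) (net_comp f v)).
Proof.
  intros Hf [p1 Hu] [p2 Hv] Hw.
  destruct (moderate_tau_closed f Hf) as [Sf [F1 F2]].
  apply (moderate0_le D u p1 (p1 + p2)) in Hu; [|lia].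
  apply (moderate0_le D v p2 (p1 + p2)) in Hv; [|lia].
  destruct Hu as [K1 [K10 HK1]], Hv as [K2 [K20 HK2]].
  set (p := (p1 + p2)%nat) in *.
  (* Both nets lie in the ball of radius [(K1 + K2) * / e ^ p], and [smooth2_lipschitz] requires
     bounds on the ball four times larger. *)
  destruct (moderate_growth_ball _ p (4 * (K1 + K2)) (moderate_tau_growth _ F1)) as [q1 [L1 [L10 HL1]]]; [lra|].
  destruct (moderate_growth_ball _ p (4 * (K1 + K2)) (moderate_tau_growth _ F2)) as [q2 [L2 [L20 HL2]]]; [lra|].
  apply (negligible0_scaled D (net_minus u v) _ (q1 + q2) (4 * (L1 + L2))); [lra| |exact Hw].
  generalize (eventually0_and _ _ (eventually0_and _ _ HK1 HK2) (eventually0_and _ _ HL1 HL2)).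
  apply eventually0_imp; intros e [[H1 H2] [H3 H4]] x Dx. unfold net_minus, net_comp.
  rewrite (Rmult_assoc 4).
  assert (Q1 := index_inv_pow_le e q1 (q1 + q2) ltac:(lia)).
  assert (Q2 := index_inv_pow_le e q2 (q1 + q2) ltac:(lia)).
  assert (P := index_inv_pow_pos e (q1 + q2)). assert (Pp := index_inv_pow_pos e p).
  assert (R1 := Rmult_le_compat_l _ _ _ L10 Q1). assert (R2 := Rmult_le_compat_l _ _ _ L20 Q2).
  assert (R3 := Rmult_le_pos _ _ L10 (Rlt_le _ _ P)). assert (R4 := Rmult_le_pos _ _ L20 (Rlt_le _ _ P)).
  assert (R5 := Rmult_le_pos _ _ K10 (Rlt_le _ _ Pp)). assert (R6 := Rmult_le_pos _ _ K20 (Rlt_le _ _ Pp)).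
  apply (smooth2_lipschitz (f e) ((K1 + K2) * / proj1_sig e ^ p)); [apply Sf | | |].
  - intros z Hz. rewrite <- Rmult_assoc in Hz. split.
    + eapply Rle_trans; [apply (H3 z Hz)|]. lra.
    + eapply Rle_trans; [apply (H4 z Hz)|]. lra.
  - eapply Rle_trans; [apply (H1 x Dx)|]. lra.
  - eapply Rle_trans; [apply (H2 x Dx)|]. lra.
Qed.

(** * Quotients *)

(** Successive derivatives are listed explicitly, with identities asserted on [D] only: outside [D]
    the values of [derive_in] are not controlled, so [derive_n_in] can be compared with a formula
    only at points of [D]. *)
Definition chain (D : R -> Prop) (F : nat -> R -> C) : Prop :=
  forall n x, D x -> is_derive_in D (F n) x (F (S n) x).

Lemma chain_derive_n (D : R -> Prop) (F : nat -> R -> C) :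
  upward D -> chain D F -> forall n x, D x -> derive_n_in D n (F 0%nat) x = F n x.
Proof.
  intros HD HF n; induction n as [|n IH]; intros x Dx; simpl; [reflexivity|].
  apply derive_in_unique; [exact HD | exact Dx|].
  apply (is_derive_in_ext D (F n)); [|exact Dx | apply HF, Dx].
  intros y Dy; symmetry; apply IH, Dy.
Qed.

Lemma chain_smooth (D : R -> Prop) (F : nat -> R -> C) :
  upward D -> chain D F -> smooth_in D (F 0%nat).
Proof.
  intros HD HF n x Dx. exists (F (S n) x).
  apply (is_derive_in_ext D (F n)); [|exact Dx | apply HF, Dx].
  intros y Dy; symmetry; apply chain_derive_n; assumption.
Qed.

Lemma smooth_chain (D : R -> Prop) (f : R -> C) :
  upward D -> smooth_in D f -> chain D (fun n => derive_n_in D n f).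
Proof. intros HD Hf n x Dx; apply derive_in_correct; auto. Qed.

Lemma smooth_in_plus (D : R -> Prop) (f g : R -> C) :
  upward D -> smooth_in D f -> smooth_in D g ->
  smooth_in D (lift2 Cplus f g) /\
  forall n x, D x ->
    derive_n_in D n (lift2 Cplus f g) x = lift2 Cplus (derive_n_in D n f) (derive_n_in D n g) x.
Proof.
  intros HD Hf Hg.
  assert (H : chain D (fun n => lift2 Cplus (derive_n_in D n f) (derive_n_in D n g))).
  { intros n x Dx; apply is_derive_in_plus; apply smooth_chain; assumption. }
  split; [exact (chain_smooth D _ HD H) | exact (chain_derive_n D _ HD H)].
Qed.

Lemma smooth_in_minus (D : R -> Prop) (f g : R -> C) :
  upward D -> smooth_in D f -> smooth_in D g ->
  smooth_in D (lift2 Cminus f g) /\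
  forall n x, D x ->
    derive_n_in D n (lift2 Cminus f g) x = lift2 Cminus (derive_n_in D n f) (derive_n_in D n g) x.
Proof.
  intros HD Hf Hg.
  assert (H : chain D (fun n => lift2 Cminus (derive_n_in D n f) (derive_n_in D n g))).
  { intros n x Dx; apply is_derive_in_minus; apply smooth_chain; assumption. }
  split; [exact (chain_smooth D _ HD H) | exact (chain_derive_n D _ HD H)].
Qed.

Lemma smooth_in_restrict (D : R -> Prop) (f : R -> C) :
  upward D -> smooth_in allR f ->
  smooth_in D f /\ forall n x, D x -> derive_n_in D n f x = derive_n_in allR n f x.
Proof.
  intros HD Hf.
  assert (H : chain D (fun n => derive_n_in allR n f)).
  { intros n x Dx; apply is_derive_in_allR_restrict; [exact Dx|].
    apply (smooth_chain allR f upward_allR Hf n x I). }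
  split; [exact (chain_smooth D _ HD H) | exact (chain_derive_n D _ HD H)].
Qed.

(** These are the properties of the underlying space on which the calculus of classes rests. *)
Record space_on (D : R -> Prop) (X : (R -> C) -> Prop) : Prop := {
  space_upward : upward D;
  space_inhabited : exists x, D x;
  space_plus : forall f g, X f -> X g -> X (lift2 Cplus f g);
  space_minus : forall f g, X f -> X g -> X (lift2 Cminus f g);
  space_smooth : forall f, X f -> smooth_in D f }.

(** [B_aaa], [B_aa] and [B_on allR] are convertible to instances of this. [B_p0] combines two such
    conditions and gets its own treatment. *)
Definition smooth_space (X : (R -> C) -> Prop) (f : R -> C) : Prop :=
  smooth_in allR f /\ forall n, X (derive_n_in allR n f).

Lemma derive_n_plus (f g : R -> C) (n : nat) :
  smooth_in allR f -> smooth_in allR g ->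
  derive_n_in allR n (lift2 Cplus f g) = lift2 Cplus (derive_n_in allR n f) (derive_n_in allR n g).
Proof.
  intros Hf Hg; apply functional_extensionality; intros x.
  exact (proj2 (smooth_in_plus allR f g upward_allR Hf Hg) n x I).
Qed.

Lemma derive_n_minus (f g : R -> C) (n : nat) :
  smooth_in allR f -> smooth_in allR g ->
  derive_n_in allR n (lift2 Cminus f g) = lift2 Cminus (derive_n_in allR n f) (derive_n_in allR n g).
Proof.
  intros Hf Hg; apply functional_extensionality; intros x.
  exact (proj2 (smooth_in_minus allR f g upward_allR Hf Hg) n x I).
Qed.

Lemma smooth_space_on (X : (R -> C) -> Prop) : loclip_closed X -> space_on allR (smooth_space X).
Proof.
  intros H; split.
  - apply upward_allR.
  - exists 0; exact I.
  - intros f g [F1 F2] [G1 G2]; split; [apply (smooth_in_plus allR f g upward_allR F1 G1)|].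
    intros n; rewrite derive_n_plus by assumption. apply H; auto using loclip2_plus.
  - intros f g [F1 F2] [G1 G2]; split; [apply (smooth_in_minus allR f g upward_allR F1 G1)|].
    intros n; rewrite derive_n_minus by assumption. apply H; auto using loclip2_minus.
  - intros f Hf; apply Hf.
Qed.

Lemma space_B_aaa : space_on allR B_aaa.
Proof. exact (smooth_space_on C_aaa loclip_closed_C_aaa). Qed.

Lemma space_B_aa : space_on allR B_aa.
Proof. exact (smooth_space_on C_aa loclip_closed_C_aa). Qed.

Lemma space_B : space_on allR (B_on allR).
Proof. exact (smooth_space_on (bounded_on allR) (loclip_closed_bounded allR)). Qed.

Lemma tends_to_0_minus (f g : R -> C) :
  tends_to_0_at_infty f -> tends_to_0_at_infty g -> tends_to_0_at_infty (lift2 Cminus f g).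
Proof.
  intros Hf Hg. unfold tends_to_0_at_infty. replace (RtoC 0) with (Cminus (RtoC 0) (RtoC 0)) by ring.
  apply loclip2_filterlim; [apply Rbar_locally_filter | apply loclip2_minus | exact Hf | exact Hg].
Qed.

Lemma space_B_p0 : space_on allR B_p0.
Proof.
  destruct space_B as [HU HI HP HM HS]; split; [exact HU | exact HI | | |].
  - intros f g [F1 F2] [G1 G2]; split; [auto|]. intros n.
    rewrite derive_n_plus by auto. apply tends_to_0_plus; auto.
  - intros f g [F1 F2] [G1 G2]; split; [auto|]. intros n.
    rewrite derive_n_minus by auto. apply tends_to_0_minus; auto.
  - intros f [F1 F2]; auto.
Qed.

Lemma bounded_on_ext (D : R -> Prop) (f g : R -> C) :
  (forall x, D x -> f x = g x) -> bounded_on D g -> bounded_on D f.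
Proof. intros H [M HM]; exists M; intros x Dx; rewrite H by exact Dx; auto. Qed.

Lemma space_B_J : space_on J (B_on J).
Proof.
  split.
  - apply upward_J.
  - exists 0; unfold J; lra.
  - intros f g [F1 F2] [G1 G2]. destruct (smooth_in_plus J f g upward_J F1 G1) as [S1 S2].
    split; [exact S1|]. intros n; apply (bounded_on_ext J _ _ (S2 n)).
    apply loclip_closed_bounded; auto using loclip2_plus.
  - intros f g [F1 F2] [G1 G2]. destruct (smooth_in_minus J f g upward_J F1 G1) as [S1 S2].
    split; [exact S1|]. intros n; apply (bounded_on_ext J _ _ (S2 n)).
    apply loclip_closed_bounded; auto using loclip2_minus.
  - intros f Hf; apply Hf.
Qed.

Lemma B_on_restrict_J (f : R -> C) : B_on allR f -> B_on J f.
Proof.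
  intros [H1 H2]. destruct (smooth_in_restrict J f upward_J H1) as [S1 S2].
  split; [exact S1|]. intros n; apply (bounded_on_ext J _ _ (S2 n)).
  destruct (H2 n) as [M HM]; exists M; intros x _; apply HM, I.
Qed.

(** * Group structure of moderate and negligible nets, and equality of classes *)

Lemma moderate_plus (D : R -> Prop) (X : (R -> C) -> Prop) (HX : space_on D X)
    (u v : net) :
  moderate D X u -> moderate D X v -> moderate D X (net_plus u v).
Proof.
  destruct HX as [HU HI HP HM HS]. rewrite !moderate_iff by exact HI.
  intros [U1 U2] [V1 V2]; split; [intros e; apply HP; auto|].
  intros n; destruct (moderate0_add D _ _ (net_plus (net_deriv D n u) (net_deriv D n v))
    (fun e x => Cmod_plus_le _ _) (U2 n) (V2 n)) as [m Hm]; exists m; revert Hm; apply dominated_le; [|intros; lra].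
  intros e x Dx. right; f_equal. apply (smooth_in_plus D (u e) (v e)); auto.
Qed.

Lemma moderate_minus (D : R -> Prop) (X : (R -> C) -> Prop) (HX : space_on D X)
    (u v : net) :
  moderate D X u -> moderate D X v -> moderate D X (net_minus u v).
Proof.
  destruct HX as [HU HI HP HM HS]. rewrite !moderate_iff by exact HI.
  intros [U1 U2] [V1 V2]; split; [intros e; apply HM; auto|].
  intros n; destruct (moderate0_add D _ _ (net_minus (net_deriv D n u) (net_deriv D n v))
    (fun e x => Cmod_minus_le _ _) (U2 n) (V2 n)) as [m Hm]; exists m; revert Hm; apply dominated_le; [|intros; lra].
  intros e x Dx. right; f_equal. apply (smooth_in_minus D (u e) (v e)); auto.
Qed.

Lemma negligible_plus (D : R -> Prop) (X : (R -> C) -> Prop) (HX : space_on D X)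
    (u v : net) :
  negligible D X u -> negligible D X v -> negligible D X (net_plus u v).
Proof.
  destruct HX as [HU HI HP HM HS]. rewrite !negligible_iff by exact HI.
  intros [U1 U2] [V1 V2]; split; [intros e; apply HP; auto|].
  intros n m; generalize (negligible0_add D _ _ (net_plus (net_deriv D n u) (net_deriv D n v))
    (fun e x => Cmod_plus_le _ _) (U2 n) (V2 n) m); apply dominated_le; [|intros; lra].
  intros e x Dx. right; f_equal. apply (smooth_in_plus D (u e) (v e)); auto.
Qed.

Lemma negligible_minus (D : R -> Prop) (X : (R -> C) -> Prop) (HX : space_on D X)
    (u v : net) :
  negligible D X u -> negligible D X v -> negligible D X (net_minus u v).
Proof.
  destruct HX as [HU HI HP HM HS]. rewrite !negligible_iff by exact HI.
  intros [U1 U2] [V1 V2]; split; [intros e; apply HM; auto|].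
  intros n m; generalize (negligible0_add D _ _ (net_minus (net_deriv D n u) (net_deriv D n v))
    (fun e x => Cmod_minus_le _ _) (U2 n) (V2 n) m); apply dominated_le; [|intros; lra].
  intros e x Dx. right; f_equal. apply (smooth_in_minus D (u e) (v e)); auto.
Qed.

Lemma negligible_refl (D : R -> Prop) (X : (R -> C) -> Prop) (HX : space_on D X)
    (u : net) :
  each X u -> negligible D X (net_minus u u).
Proof.
  destruct HX as [HU HI HP HM HS]. rewrite negligible_iff by exact HI.
  intros U1; split; [intros e; apply HM; auto|].
  intros n m; exists 0; split; [lra|]. exists 1; split; [lra|]. intros e _ x Dx.
  rewrite Rmult_0_l, <- Cmod_0. right; f_equal.
  etransitivity; [apply (smooth_in_minus D (u e) (u e)); auto|]. unfold lift2; ring.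
Qed.

Lemma negligible_sym (D : R -> Prop) (X : (R -> C) -> Prop) (HX : space_on D X)
    (u v : net) :
  negligible D X (net_minus u v) -> negligible D X (net_minus v u).
Proof.
  intros H. assert (H0 := negligible_refl D X HX _ (proj1 H)).
  (* The opposite of a difference [d] is obtained as [(d - d) - d], from closure under
     subtraction. *)
  replace (net_minus v u) with
    (net_minus (net_minus (net_minus u v) (net_minus u v)) (net_minus u v)).
  - apply (negligible_minus D X HX); assumption.
  - apply net_ext; intros; unfold net_minus; ring.
Qed.

Lemma negligible_trans (D : R -> Prop) (X : (R -> C) -> Prop) (HX : space_on D X)
    (u v w : net) :
  negligible D X (net_minus u v) -> negligible D X (net_minus v w) -> negligible D X (net_minus u w).
Proof.
  intros H1 H2. replace (net_minus u w) with (net_plus (net_minus u v) (net_minus v w)).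
  - apply (negligible_plus D X HX); assumption.
  - apply net_ext; intros; unfold net_minus, net_plus; ring.
Qed.

(** This is the well-definedness criterion for operations on classes: once all values of the formula
    are equivalent to one of them, the union of their classes is a single class. *)
Lemma class_of_eq (D : R -> Prop) (X : (R -> C) -> Prop) (HX : space_on D X)
    (P : net -> Prop) (u0 : net) :
  P u0 -> (forall u, P u -> negligible D X (net_minus u u0)) -> class_of D X P = class D X u0.
Proof.
  intros H0 H. apply functional_extensionality; intros w; apply propositional_extensionality.
  split; intros [Hw [u [Hu Hn]]]; (split; [exact Hw|]).
  - exists u0; split; [reflexivity|]. apply (negligible_trans D X HX w u u0); auto.
  - subst u; exists u0; split; assumption.
Qed.

Lemma class_refl (D : R -> Prop) (X : (R -> C) -> Prop) (HX : space_on D X)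
    (u : net)  : moderate D X u -> class D X u u.
Proof.
  intros H; split; [exact H|]. exists u; split; [reflexivity | exact (negligible_refl D X HX u (proj1 H))].
Qed.

Lemma class_negligible (D : R -> Prop) (X : (R -> C) -> Prop) (u v : net) : class D X u v -> negligible D X (net_minus v u).
Proof. intros [_ [u' [-> H]]]; exact H. Qed.

Lemma class_eq_iff (D : R -> Prop) (X : (R -> C) -> Prop) (HX : space_on D X)
    (u v : net) :
  moderate D X u -> 
  class D X u = class D X v <-> negligible D X (net_minus u v).
Proof.
  intros Hu; split.
  - intros E. apply class_negligible. rewrite <- E; apply (class_refl D X HX), Hu.
  - intros H. apply functional_extensionality; intros w; apply propositional_extensionality.
    split; intros [Hw [u' [-> Hn]]]; (split; [exact Hw|]); eexists; (split; [reflexivity|]).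
    + apply (negligible_trans D X HX w u v); assumption.
    + apply (negligible_trans D X HX w v u); [assumption | apply (negligible_sym D X HX), H].
Qed.

(** * Embedding into bounded generalized functions, restriction to the half-line, sum and
    difference *)

Lemma moderate_incl (D : R -> Prop) (X Y : (R -> C) -> Prop) (u : net) :
  (forall f, X f -> Y f) -> moderate D X u -> moderate D Y u.
Proof. intros H [H1 H2]; split; auto. Qed.

Lemma negligible_incl (D : R -> Prop) (X Y : (R -> C) -> Prop) (u : net) :
  (forall f, X f -> Y f) -> negligible D X u -> negligible D Y u.
Proof. intros H [H1 H2]; split; auto. Qed.

Lemma embed_class (X : (R -> C) -> Prop) (u : net) :
  space_on allR X -> (forall f, X f -> B_on allR f) -> moderate allR X u ->
  embed (class allR X u) = class allR (B_on allR) u.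
Proof.
  intros HX HB Hu. apply (class_of_eq _ _ space_B).
  - apply class_refl; assumption.
  - intros v Hv. apply (negligible_incl allR X); [exact HB|]. apply class_negligible, Hv.
Qed.

(** For a function smooth on the line, derivatives within [J] coincide with the ordinary ones at
    every point of [J], end point included. This lets the half-line case use the chain rule of the
    whole line. *)
Lemma negligible0_restrict_J (u : net) (n : nat) :
  (forall e, smooth_in allR (u e)) ->
  negligible0 J (net_deriv J n u) <-> negligible0 J (net_deriv allR n u).
Proof.
  intros Hu.
  assert (E : forall e x, J x -> net_deriv J n u e x = net_deriv allR n u e x).
  { intros e; apply (smooth_in_restrict J (u e) upward_J (Hu e)). }
  split; intros H m; generalize (H m); apply dominated_le; try (intros; lra);
    intros e x Jx; rewrite E by exact Jx; lra.
Qed.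

Lemma moderate_restrict_J (u : net) : moderate allR (B_on allR) u -> moderate J (B_on J) u.
Proof.
  rewrite (moderate_iff allR) by apply (space_inhabited _ _ space_B).
  rewrite (moderate_iff J) by apply (space_inhabited _ _ space_B_J).
  intros [H1 H2]; split; [intros e; apply B_on_restrict_J, H1|].
  intros n; destruct (H2 n) as [m [K [K0 HK]]]; exists m, K; split; [exact K0|].
  revert HK; apply eventually0_imp; intros e He x Jx.
  unfold net_deriv. rewrite (proj2 (smooth_in_restrict J (u e) upward_J (proj1 (H1 e))) n x Jx).
  apply He, I.
Qed.

Lemma negligible_restrict_J (u : net) : negligible allR (B_on allR) u -> negligible J (B_on J) u.
Proof.
  rewrite (negligible_iff allR) by apply (space_inhabited _ _ space_B).
  rewrite (negligible_iff J) by apply (space_inhabited _ _ space_B_J).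
  intros [H1 H2]; split; [intros e; apply B_on_restrict_J, H1|].
  intros n; apply negligible0_restrict_J; [intros e; apply H1|].
  intros m; destruct (H2 n m) as [K [K0 HK]]; exists K; split; [exact K0|].
  revert HK; apply eventually0_imp; intros e He x _; apply He, I.
Qed.

Lemma eq_on_J_class (u v : net) :
  moderate allR (B_on allR) u -> moderate allR (B_on allR) v ->
  eq_on_J (class allR (B_on allR) u) (class allR (B_on allR) v) <->
  negligible J (B_on J) (net_minus u v).
Proof.
  intros Hu Hv.
  assert (R : forall w, moderate allR (B_on allR) w ->
    restrict_J (class allR (B_on allR) w) = class J (B_on J) w).
  { intros w Hw. apply (class_of_eq _ _ space_B_J).
    - apply class_refl; [apply space_B | exact Hw].
    - intros w' Hw'. apply negligible_restrict_J, class_negligible, Hw'. }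
  unfold eq_on_J. rewrite !R by assumption.
  apply (class_eq_iff _ _ space_B_J), moderate_restrict_J, Hu.
Qed.

Lemma gplus_class (u v : net) :
  moderate allR (B_on allR) u -> moderate allR (B_on allR) v ->
  gplus (class allR (B_on allR) u) (class allR (B_on allR) v) = class allR (B_on allR) (net_plus u v).
Proof.
  intros Hu Hv. apply (class_of_eq _ _ space_B).
  - exists u, v; split; [|split; [|reflexivity]]; apply class_refl; auto using space_B.
  - intros w [u' [v' [Hu' [Hv' ->]]]]. apply class_negligible in Hu', Hv'.
    replace (net_minus (net_plus u' v') (net_plus u v))
      with (net_plus (net_minus u' u) (net_minus v' v)).
    + apply (negligible_plus _ _ space_B); assumption.
    + apply net_ext; intros; unfold net_minus, net_plus; ring.
Qed.

Lemma gminus_class (u v : net) :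
  moderate allR (B_on allR) u -> moderate allR (B_on allR) v ->
  gminus (class allR (B_on allR) u) (class allR (B_on allR) v) = class allR (B_on allR) (net_minus u v).
Proof.
  intros Hu Hv. apply (class_of_eq _ _ space_B).
  - exists u, v; split; [|split; [|reflexivity]]; apply class_refl; auto using space_B.
  - intros w [u' [v' [Hu' [Hv' ->]]]]. apply class_negligible in Hu', Hv'.
    replace (net_minus (net_minus u' v') (net_minus u v))
      with (net_minus (net_minus u' u) (net_minus v' v)).
    + apply (negligible_minus _ _ space_B); assumption.
    + apply net_ext; intros; unfold net_minus; ring.
Qed.

(** * Composition in the spaces with all derivatives *)

Lemma moderate_smooth_space (X : (R -> C) -> Prop) (u : net) :
  moderate allR (smooth_space X) u <->
  smooth_net (each X) u /\ smooth_net (moderate0 allR) u.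
Proof.
  rewrite moderate_iff by (exists 0; exact I). rewrite !smooth_net_iff.
  split.
  - intros [H1 H2]; repeat split; try (intros n e; apply (H1 e)); try (intros e; apply (H1 e)); exact H2.
  - intros [[H1 H2] [_ H3]]; split; [intros e; split; [apply H1 | intros n; apply H2] | exact H3].
Qed.

Lemma negligible_smooth_space (X : (R -> C) -> Prop) (u : net) :
  negligible allR (smooth_space X) u <->
  smooth_net (each X) u /\ smooth_net (negligible0 allR) u.
Proof.
  rewrite negligible_iff by (exists 0; exact I). rewrite !smooth_net_iff.
  split.
  - intros [H1 H2]; repeat split; try (intros n e; apply (H1 e)); try (intros e; apply (H1 e)); exact H2.
  - intros [[H1 H2] [_ H3]]; split; [intros e; split; [apply H1 | intros n; apply H2] | exact H3].
Qed.

Lemma smooth_net_each_comp (X : (R -> C) -> Prop) (f : net2) (u : net) :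
  loclip_closed X -> moderate_tau f -> smooth_net (each X) u -> smooth_net (each X) (net_comp f u).
Proof.
  intros HX Hf Hu n. apply (derivs_comp moderate_tau (each X)); auto using moderate_tau_closed, each_module.
  intros g v [Hg _] Hv; apply each_comp; assumption.
Qed.

Lemma smooth_net_moderate_comp (D : R -> Prop) (f : net2) (u : net) :
  moderate_tau f -> smooth_net (moderate0 D) u -> smooth_net (moderate0 D) (net_comp f u).
Proof.
  intros Hf Hu n. apply (derivs_comp moderate_tau (moderate0 D));
    auto using moderate_tau_closed, moderate0_module, moderate0_comp.
Qed.

Lemma smooth_net_negligible_comp (D : R -> Prop) (f : net2) (u : net) :
  negligible_tau f -> smooth_net (moderate0 D) u -> smooth_net (negligible0 D) (net_comp f u).
Proof.
  intros Hf Hu n. apply (derivs_comp negligible_tau (moderate0 D));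
    auto using negligible_tau_closed, negligible0_module, negligible0_comp.
Qed.

Lemma smooth_net_comp_minus (D : R -> Prop) (f : net2) (u v : net) :
  moderate_tau f -> smooth_net (moderate0 D) u -> smooth_net (moderate0 D) v ->
  smooth_net (negligible0 D) (net_minus u v) ->
  smooth_net (negligible0 D) (net_minus (net_comp f u) (net_comp f v)).
Proof.
  intros Hf Hu Hv Hw n. apply (derivs_comp_minus moderate_tau (moderate0 D));
    auto using moderate_tau_closed, moderate0_module, negligible0_module,
      negligible0_Re, negligible0_Im, moderate0_comp, negligible0_comp_minus.
Qed.

Lemma each_tends_to_0_comp_minus (f : net2) (u v : net) :
  (forall e, smooth2 (f e)) -> each (bounded_on allR) u -> each (bounded_on allR) v ->
  each tends_to_0_at_infty (net_minus u v) ->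
  each tends_to_0_at_infty (net_minus (net_comp f u) (net_comp f v)).
Proof.
  intros Hf Hu Hv Hw e.
  exact (tends_to_0_lift2 (fun z _ => f e z) (u e) (u e) (v e) (v e) (loclip2_smooth2 _ (Hf e))
    (Hu e) (Hu e) (Hv e) (Hv e) (Hw e) (Hw e)).
Qed.

Lemma smooth_net_tends_to_0_comp_minus (f : net2) (u v : net) :
  moderate_tau f -> smooth_net (each (bounded_on allR)) u -> smooth_net (each (bounded_on allR)) v ->
  smooth_net (each tends_to_0_at_infty) (net_minus u v) ->
  smooth_net (each tends_to_0_at_infty) (net_minus (net_comp f u) (net_comp f v)).
Proof.
  intros Hf Hu Hv Hw n. apply (derivs_comp_minus moderate_tau (each (bounded_on allR))); auto.
  - apply moderate_tau_closed.
  - apply each_module, loclip_closed_bounded.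
  - apply tends_to_0_module.
  - intros w H e. apply (tends_to_0_dominated _ (w e) 1); [|apply H].
    intros x; rewrite Rmult_1_l; apply Cmod_Re_le.
  - intros w H e. apply (tends_to_0_dominated _ (w e) 1); [|apply H].
    intros x; rewrite Rmult_1_l; apply Cmod_Im_le.
  - intros g w [Hg _] H; apply each_comp; [apply loclip_closed_bounded | exact Hg | exact H].
  - intros g w1 w2 [Hg _]; apply each_tends_to_0_comp_minus, Hg.
Qed.

(** Membership of each function in the space and growth in [e] are two separate [smooth_net]
    conditions, and each is stable under composition. *)
Lemma moderate_comp (X : (R -> C) -> Prop) (f : net2) (u : net) :
  loclip_closed X -> moderate_tau f -> moderate allR (smooth_space X) u ->
  moderate allR (smooth_space X) (net_comp f u).
Proof.
  rewrite !moderate_smooth_space. intros HX Hf [H1 H2]; split.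
  - apply smooth_net_each_comp; assumption.
  - apply smooth_net_moderate_comp; assumption.
Qed.

Lemma negligible_comp (X : (R -> C) -> Prop) (f g : net2) (u v : net) :
  loclip_closed X -> moderate_tau f -> moderate_tau g -> negligible_tau (net2_minus f g) ->
  moderate allR (smooth_space X) u -> moderate allR (smooth_space X) v ->
  negligible allR (smooth_space X) (net_minus u v) ->
  negligible allR (smooth_space X) (net_minus (net_comp f u) (net_comp g v)).
Proof.
  rewrite !moderate_smooth_space, !negligible_smooth_space.
  intros HX Hf Hg Hfg [U1 U2] [V1 V2] [W1 W2]; split.
  - intros n; apply (derivs_minus n (each X) (each X)); [intros; apply each_minus; assumption | |];
      apply smooth_net_each_comp; assumption.
  (* Changing [u] into [v] under [f] is controlled by the moderateness of [f], changing [f] into [g]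
     along [v] by the negligibility of [f - g]. *)
  - replace (net_minus (net_comp f u) (net_comp g v)) with
      (net_plus (net_minus (net_comp f u) (net_comp f v)) (net_comp (net2_minus f g) v)).
    + intros n; apply (derivs_plus n (negligible0 allR) (negligible0 allR)).
      * apply negligible0_module.
      * apply smooth_net_comp_minus; assumption.
      * apply smooth_net_negligible_comp; assumption.
    + apply net_ext; intros; unfold net_minus, net_plus, net_comp, net2_minus; ring.
Qed.

(** * Well-definedness of composition on classes *)

Lemma derive_in_const (x : R) (c : C) : derive_in allR (fun _ => c) x = RtoC 0.
Proof.
  apply derive_in_unique; [apply upward_allR | exact I|].
  apply is_derive_in_allR; split; apply (is_derive_const (V := R_NormedModule)).
Qed.

Lemma partial1_0 : partial1 (fun _ => RtoC 0) = fun _ => RtoC 0.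
Proof. apply functional_extensionality; intros z; apply derive_in_const. Qed.

Lemma partial2_0 : partial2 (fun _ => RtoC 0) = fun _ => RtoC 0.
Proof. apply functional_extensionality; intros z; apply derive_in_const. Qed.

Lemma smooth2_0 : smooth2 (fun _ => RtoC 0).
Proof.
  assert (D : forall x, ex_derive_in allR (fun _ => RtoC 0) x).
  { intros x; exists (RtoC 0). apply is_derive_in_allR; split; apply (is_derive_const (V := R_NormedModule)). }
  intros n; induction n as [|n IH].
  - split; [intros z; apply continuous_const | exact I].
  - split; [intros z; apply continuous_const|]. rewrite partial1_0, partial2_0.
    repeat split; try exact IH; apply D.
Qed.

Lemma partial_n_0 (j1 j2 : nat) : partial_n j1 j2 (fun _ => RtoC 0) = fun _ => RtoC 0.
Proof.
  unfold partial_n. replace (iter_op j2 partial2 (fun _ => RtoC 0)) with (fun _ : C => RtoC 0).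
  - induction j1 as [|n IH]; simpl; [reflexivity | rewrite IH; apply partial1_0].
  - induction j2 as [|n IH]; simpl; [reflexivity | rewrite <- IH; symmetry; apply partial2_0].
Qed.

(** A tempered net belongs to its own class only if the zero net is negligible, which includes its
    smoothness in the sense of [smooth2]. *)
Lemma negligible_tau_refl (f : net2) : negligible_tau (net2_minus f f).
Proof.
  assert (E : forall e, net2_minus f f e = fun _ => RtoC 0).
  { intros e; apply functional_extensionality; intros z; unfold net2_minus; ring. }
  apply negligible_tau_iff; split; [intros e; rewrite E; apply smooth2_0|].
  intros j1 j2; exists 0%nat; intros m; exists 0; split; [lra|].
  exists 1; split; [lra|]; intros e _ z. rewrite E, partial_n_0, Cmod_0; lra.
Qed.

Lemma class_tau_refl (f : net2) : moderate_tau f -> class_tau f f.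
Proof. intros H; split; [exact H | apply negligible_tau_refl]. Qed.

Lemma gcomp_class (X : (R -> C) -> Prop) (f : net2) (u : net) :
  loclip_closed X -> moderate_tau f -> moderate allR (smooth_space X) u ->
  gcomp (smooth_space X) (class_tau f) (class allR (smooth_space X) u) =
  class allR (smooth_space X) (net_comp f u).
Proof.
  intros HX Hf Hu. assert (HS := smooth_space_on X HX). apply (class_of_eq _ _ HS).
  - exists f, u; split; [apply class_tau_refl, Hf | split; [|reflexivity]].
    apply (class_refl _ _ HS); exact Hu.
  - intros w [g [v [[Hg Hgf] [Hv ->]]]].
    apply negligible_comp; auto; [apply Hv | apply class_negligible, Hv].
Qed.

(** Only the bounds are restricted to [J]: the hypothesis is moved to whole-line derivatives
    estimated on [J], the induction is run there, and the result is moved back. *)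
Lemma negligible_comp_J (f : net2) (u v : net) :
  moderate_tau f -> moderate allR (B_on allR) u -> moderate allR (B_on allR) v ->
  negligible J (B_on J) (net_minus u v) ->
  negligible J (B_on J) (net_minus (net_comp f u) (net_comp f v)).
Proof.
  intros Hf Hu Hv Hw.
  assert (Fu := moderate_comp _ f u (loclip_closed_bounded allR) Hf Hu).
  assert (Fv := moderate_comp _ f v (loclip_closed_bounded allR) Hf Hv).
  assert (Fw : each (B_on allR) (net_minus (net_comp f u) (net_comp f v))).
  { intros e; apply (space_minus _ _ space_B); [apply Fu | apply Fv]. }
  assert (Sw : each (B_on allR) (net_minus u v)).
  { intros e; apply (space_minus _ _ space_B); [apply Hu | apply Hv]. }
  assert (MJ : forall w, moderate allR (B_on allR) w -> smooth_net (moderate0 J) w).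
  { intros w Hw' n. apply moderate_smooth_space in Hw'.
    apply (derivs_imp n (moderate0 allR)); [|apply Hw'].
    intros g [m [K [K0 HK]]]; exists m, K; split; [exact K0|].
    revert HK; apply eventually0_imp; intros e He x _; apply He, I. }
  assert (NJ : smooth_net (negligible0 J) (net_minus (net_comp f u) (net_comp f v))).
  { apply smooth_net_comp_minus; auto.
    apply smooth_net_iff; split; [intros e; apply Sw|]. intros n.
    apply negligible0_restrict_J; [intros e; apply Sw|].
    apply (negligible_iff J) in Hw; [apply Hw | apply (space_inhabited _ _ space_B_J)]. }
  apply negligible_iff; [apply (space_inhabited _ _ space_B_J)|].
  split; [intros e; apply B_on_restrict_J, Fw|].
  intros n; apply negligible0_restrict_J; [intros e; apply Fw|].
  apply smooth_net_iff in NJ; apply NJ.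
Qed.

(** Boundedness and growth in [e] are inherited from the two compositions; the limits at infinity
    come from [w], which is the difference of the two arguments of [f]. *)
Lemma moderate_B_p0_comp_minus (f : net2) (v w : net) :
  moderate_tau f -> moderate allR (B_on allR) v -> moderate allR B_p0 w ->
  moderate allR B_p0 (net_minus (net_comp f (net_plus v w)) (net_comp f v)).
Proof.
  intros Hf Hv Hw.
  assert (Hw' : moderate allR (B_on allR) w) by (revert Hw; apply moderate_incl; intros g Hg; apply Hg).
  assert (Hvw := moderate_plus _ _ space_B v w Hv Hw').
  assert (Fvw := moderate_comp _ f _ (loclip_closed_bounded allR) Hf Hvw).
  assert (Fv := moderate_comp _ f _ (loclip_closed_bounded allR) Hf Hv).
  assert (HB := moderate_minus _ _ space_B _ _ Fvw Fv).
  split; [|apply HB]. intros e; split; [apply HB|].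
  assert (S : smooth_net (each tends_to_0_at_infty) (net_minus (net_comp f (net_plus v w)) (net_comp f v))).
  { apply smooth_net_tends_to_0_comp_minus; [exact Hf | | |].
    - apply (moderate_smooth_space (bounded_on allR)) in Hvw; apply Hvw.
    - apply (moderate_smooth_space (bounded_on allR)) in Hv; apply Hv.
    - replace (net_minus (net_plus v w) v) with w
        by (apply net_ext; intros; unfold net_minus, net_plus; ring).
      apply smooth_net_iff; split; [intros e'; apply Hw' | intros n e'; apply Hw]. }
  apply smooth_net_iff in S. intros n; apply (proj2 S n e).
Qed.

Theorem theorem4 :
  forall (U : gfun) (F : net2 -> Prop), G_aaa U -> G_tau F ->
    (G_aaa (gcomp B_aaa F U) /\
     forall (u : net) (f : net2), U u -> F f ->
       moderate allR B_aaa (net_comp f u) /\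
       gcomp B_aaa F U = class allR B_aaa (net_comp f u)) /\
    forall V W : gfun,
      principal_corrective (embed U) V W ->
      principal_corrective (embed (gcomp B_aaa F U))
        (gcomp (B_on allR) F V)
        (gminus (gcomp (B_on allR) F (gplus V W)) (gcomp (B_on allR) F V)).
Proof.
  intros U F [u0 [Hu0 ->]] [f0 [Hf0 ->]].
  assert (Gu : gcomp B_aaa (class_tau f0) (class allR B_aaa u0) = class allR B_aaa (net_comp f0 u0))
    by exact (gcomp_class C_aaa f0 u0 loclip_closed_C_aaa Hf0 Hu0).
  assert (Mu : moderate allR B_aaa (net_comp f0 u0))
    by exact (moderate_comp C_aaa f0 u0 loclip_closed_C_aaa Hf0 Hu0).
  assert (HB : forall f u, moderate_tau f -> moderate allR (B_on allR) u ->
    moderate allR (B_on allR) (net_comp f u))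
    by exact (fun f u => moderate_comp (bounded_on allR) f u (loclip_closed_bounded allR)).
  assert (GB : forall u, moderate allR (B_on allR) u ->
    gcomp (B_on allR) (class_tau f0) (class allR (B_on allR) u) = class allR (B_on allR) (net_comp f0 u))
    by exact (fun u => gcomp_class (bounded_on allR) f0 u (loclip_closed_bounded allR) Hf0).
  split; [split|].
  - rewrite Gu. exists (net_comp f0 u0); split; [exact Mu | reflexivity].
  (* Both representatives are changed at once and compared with the fixed pair [f0], [u0]. *)
  - intros u f Hu [Hf Hff0]. split.
    + exact (moderate_comp C_aaa f u loclip_closed_C_aaa Hf (proj1 Hu)).
    + rewrite Gu. apply (class_eq_iff _ _ space_B_aaa); [exact Mu|].
      apply (negligible_sym _ _ space_B_aaa).
      exact (negligible_comp C_aaa f f0 u u0 loclip_closed_C_aaa Hf Hf0 Hff0 (proj1 Hu) Hu0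
        (class_negligible _ _ _ _ Hu)).
  - intros V W [[V0 [[v0 [Hv0 ->]] ->]] [[W0 [[w0 [Hw0 ->]] ->]] HJ]].
    assert (Bu := moderate_incl _ _ _ u0 B_aaa_B_on Hu0).
    assert (Bv := moderate_incl _ _ _ v0 B_aa_B_on Hv0).
    assert (Bw : moderate allR (B_on allR) w0)
      by (revert Hw0; apply moderate_incl; intros g Hg; apply Hg).
    assert (Bvw := moderate_plus _ _ space_B v0 w0 Bv Bw).
    (* All classes are now expressed in the quotient of bounded smooth nets through [u0], [v0],
       [w0], so that the claims concern explicit nets. *)
    rewrite (embed_class B_aaa u0 space_B_aaa B_aaa_B_on Hu0) in HJ.
    rewrite (embed_class B_aa v0 space_B_aa B_aa_B_on Hv0) in *.
    rewrite (embed_class B_p0 w0 space_B_p0 (fun g Hg => proj1 Hg) Hw0) in *.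
    rewrite gplus_class in * by assumption.
    rewrite Gu, (embed_class B_aaa _ space_B_aaa B_aaa_B_on Mu), !GB by assumption.
    rewrite gminus_class by auto.
    assert (Mv : moderate allR B_aa (net_comp f0 v0))
      by exact (moderate_comp C_aa f0 v0 loclip_closed_C_aa Hf0 Hv0).
    assert (Mw := moderate_B_p0_comp_minus f0 v0 w0 Hf0 Bv Hw0).
    split; [|split].
    + exists (class allR B_aa (net_comp f0 v0)); split.
      * exists (net_comp f0 v0); split; [exact Mv | reflexivity].
      * symmetry; apply (embed_class B_aa); [apply space_B_aa | apply B_aa_B_on | exact Mv].
    + eexists; split; [eexists; split; [exact Mw | reflexivity]|].
      symmetry; apply (embed_class B_p0); [apply space_B_p0 | intros g Hg; apply Hg | exact Mw].
    + assert (Bd := moderate_minus _ _ space_B _ _ (HB f0 _ Hf0 Bvw) (HB f0 _ Hf0 Bv)).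
      rewrite gplus_class by auto.
      apply eq_on_J_class in HJ; [|assumption..].
      (* The proposed terms telescope to [f0] composed with [v0 + w0]. It remains to see that
         composition preserves the equality of [u0] and [v0 + w0] on [J]. *)
      replace (net_plus (net_comp f0 v0)
          (net_minus (net_comp f0 (net_plus v0 w0)) (net_comp f0 v0)))
        with (net_comp f0 (net_plus v0 w0))
        by (apply net_ext; intros; unfold net_minus, net_plus, net_comp; ring).
      apply eq_on_J_class; auto. apply negligible_comp_J; assumption.
Qed.
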